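(* Let $E$ be a Polish space and let $c:E\times E\to[0,\infty)$ be a lower semicontinuous quasi-pseudo-metric. For any $E$-valued random variables $X,Y$ such that $$\mathbb{E}[c(X,x_0)+c(x_0,X)+c(Y,x_0)+c(x_0,Y)]<\infty$$ for some $x_0\in E$, we have $$\mathrm{OT}_c(X,Y)=\sup\{\mathbb{E}[f(X)-f(Y)]:\ f\in\mathcal{L}_1(E,c)\}.$$
   Context: A quasi-pseudo-metric on $E$ is a map $c:E\times E\to[0,\infty)$ with $c(x,x)=0$ for all $x\in E$ and $c(x,z)\le c(x,y)+c(y,z)$ for all $x,y,z\in E$. All random variables are defined on a joint probability space. $\mathrm{OT}_c(X,Y):=\inf \mathbb{E}[c(\tilde X,\tilde Y)]$, where the infimum is over all couplings, i.e. all pairs $(\tilde X,\tilde Y)$ of $E$-valued random variables with $\tilde X\overset{d}{=}X$ and $\tilde Y\overset{d}{=}Y$ (equality in law). $\mathcal{L}_1(E,c):=\{f:E\to\mathbb{R}:\ f(x)-f(y)\le c(x,y)\text{ for all }x,y\in E\}$ is the set of 1-Lipschitz functions with respect to $c$.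
   Formalization: The supremum is taken over the Borel measurable functions in L_1(E,c), since for non-measurable f the expectation can be undefined or the equality can fail; couplings in OT_c may live on any probability space. *)

(* Defs.v *)
From HB Require Import structures.
From mathcomp Require Import all_boot all_order all_algebra.
From mathcomp Require Import all_classical all_reals all_analysis.

Set Implicit Arguments.
Unset Strict Implicit.
Unset Printing Implicit Defensive.

Import Order.TTheory GRing.Theory Num.Theory.
Import numFieldNormedType.Exports.

Local Open Scope classical_set_scope.
Local Open Scope ring_scope.

Definition separable (E : topologicalType) : Prop :=
  exists2 S : set E, countable S & dense S.

Definition is_metric (R : realType) (E : Type) (d : E -> E -> R) : Prop :=
  [/\ forall x, d x x = 0,
      forall x y, d x y = 0 -> x = y,
      forall x y, d x y = d y x
    & forall x y z, d x z <= d x y + d y z].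

Definition metric_compatible (R : realType) (E : topologicalType)
    (d : E -> E -> R) : Prop :=
  forall (x : E) (A : set E),
    nbhs x A <-> exists2 e : R, 0 < e & [set y | d x y < e] `<=` A.

Definition metric_complete (R : realType) (E : topologicalType)
    (d : E -> E -> R) : Prop :=
  forall u : nat -> E,
    (forall e : R, 0 < e ->
       exists N, forall m n, (N <= m)%N -> (N <= n)%N -> d (u m) (u n) < e) ->
    exists l : E, u @ \oo --> l.

Definition polish (R : realType) (E : topologicalType) : Prop :=
  separable E /\
  exists d : E -> E -> R,
    [/\ is_metric d, metric_compatible d & metric_complete d].

Notation borel E := (g_sigma_algebraType (@open E)).

Definition quasi_pseudo_metric (R : realType) (E : Type) (c : E -> E -> R) :
    Prop :=
  [/\ forall x y, 0 <= c x y,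
      forall x, c x x = 0
    & forall x y z, c x z <= c x y + c y z].

(* [distribution] is a pushforward evaluated on all sets, so the laws are
   compared on measurable sets only. *)
Definition eq_in_law (R : realType) d1 d2 d (T : measurableType d)
    (O1 : measurableType d1) (P1 : probability O1 R) (X1 : {RV P1 >-> T})
    (O2 : measurableType d2) (P2 : probability O2 R) (X2 : {RV P2 >-> T}) :
    Prop :=
  forall A : set T, measurable A ->
    distribution P1 X1 A = distribution P2 X2 A.

(* A coupling may live on any probability space: on the space carrying X and Y
   there may be too few pairs with the prescribed marginal laws, for instance
   when that space is finite. *)
Definition OT (R : realType) (E : ptopologicalType) (c : E -> E -> R)
    (d : measure_display) (O : measurableType d) (P : probability O R)
    (X Y : {RV P >-> borel E}) : \bar R :=
  ereal_inf [set r : \bar R |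
    exists (d' : measure_display) (O' : measurableType d')
           (P' : probability O' R) (X' Y' : {RV P' >-> borel E}),
      [/\ eq_in_law X' X, eq_in_law Y' Y
        & r = ('E_P'[(fun w => c (X' w) (Y' w))])%E]].

Definition Lip1 (R : realType) (E : Type) (c : E -> E -> R) : set (E -> R) :=
  [set f | forall x y, f x - f y <= c x y].

(* As c need not be continuous, a function in [Lip1 c] need not be measurable
   (take c x y = 1 for x <> y), whereas E[f(X) - f(Y)] only makes sense for a
   measurable f. *)
Definition measurable_Lip1 (R : realType) (E : ptopologicalType)
    (c : E -> E -> R) : set (E -> R) :=
  [set f | Lip1 c f /\ measurable_fun [set: borel E] (f : borel E -> R)].

(* Main.v *)
(** The inequality [sup <= OT] is integration of [f x - f y <= c x y].  For the
    converse let [S] be the supremum, assumed finite.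

    If [phi x + psi y + c x y >= 0] with [phi], [psi] measurable and finitely
    valued, choose a compact piece of each level set of [psi], with union [K]
    of almost full measure: [f x = inf_(y in K) (c x y + psi y)] is c-Lipschitz,
    [- phi <= f] everywhere and [f <= psi] on [K].  Compactness makes its sublevel
    sets countable unions of closed sets, so [f] is Borel and [S] bounds
    [E f(X) - E f(Y)]; hence [E phi(X) + E psi(Y) + S >= 0].

    Hahn-Banach turns this into a positive linear functional [L] on the bounded
    functions on [E * E] with the marginals of [X] and [Y] and with [L g <= S]
    whenever [g <= c].  [L] is only finitely additive, but its marginals are
    countably additive, so along countable partitions of [E] of mesh tending to
    [0] its values on cells are the lengths of nested intervals of [[0, 1)].  A
    Lebesgue-random point thus selects nested cells, which shrink to a point of
    [E * E] by completeness; the pair obtained is a coupling, and its cost is at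
    most [S] by Fatou's lemma, [c] being lower semicontinuous. *)

Require Import Defs.
From HB Require Import structures.
From mathcomp Require Import all_boot all_order all_algebra.
From mathcomp Require Import all_classical all_reals all_analysis.
From mathcomp Require Import measurable_realfun ring lra.
Set Implicit Arguments.
Unset Strict Implicit.
Unset Printing Implicit Defensive.

Import Order.TTheory GRing.Theory Num.Theory.
Import numFieldNormedType.Exports.
Local Open Scope classical_set_scope.
Local Open Scope ring_scope.

(** * Hahn-Banach theorem by minimal sublinear functionals *)

Section hahn_banach.
Context {R : realType} {V : lmodType R} (B : V -> Prop).
Hypothesis BD : forall g h, B g -> B h -> B (g + h).
Hypothesis BZ : forall (k : R) g, B g -> B (k *: g).

(** Homogeneity is asked only as an inequality, the form that passes directly to infima. For
    [k > 0], using it also with the inverse of [k] restores equality. *)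
Definition sublinear (q : V -> R) :=
  (forall g h, B g -> B h -> q (g + h) <= q g + q h) /\
  (forall (k : R) g, 0 <= k -> B g -> q (k *: g) <= k * q g).

Let BN g : B g -> B (- g). Proof. by move=> /(BZ (-1)); rewrite scaleN1r. Qed.

Let sublinear0 q g : sublinear q -> B g -> q 0 = 0.
Proof.
move=> [qD qZ] Bg; have B0 : B 0 by rewrite -(scale0r g); exact: BZ.
have := qD _ _ B0 B0; have := qZ 0 g (lexx _) Bg.
by rewrite scale0r mul0r addr0 => ? ?; lra.
Qed.

Let sublinearN q g : sublinear q -> B g -> - q (- g) <= q g.
Proof.
move=> sq Bg; have := sq.1 g (- g) Bg (BN Bg).
by rewrite subrr (sublinear0 sq Bg) => ?; lra.
Qed.

Let sublinearZ q (k : R) g : sublinear q -> 0 <= k -> B g ->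
  q (k *: g) = k * q g.
Proof.
move=> sq k0 Bg; apply/eqP; rewrite eq_le sq.2//=.
have [->|kn0] := eqVneq k 0; first by rewrite scale0r (sublinear0 sq Bg) mul0r.
have := sq.2 k^-1 (k *: g); rewrite invr_ge0 scalerA mulVf// scale1r.
move=> /(_ k0 (BZ _ Bg)) h; rewrite -ler_pdivlMl// lt_neqAle eq_sym kn0 k0 //.
Qed.

(** Each member satisfies [q g >= - q (- g) >= - p (- g)], so the infimum is finite. For
    subadditivity, the members chosen for the two summands are both replaced by the smaller one,
    which exists in a chain. *)
Let chain_inf (p : V -> R) (A : set (V -> R)) :
    (forall q, A q -> sublinear q /\ (forall g, B g -> q g <= p g)) ->
    (forall q r, A q -> A r ->
      (forall g, B g -> q g <= r g) \/ (forall g, B g -> r g <= q g)) ->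
    A !=set0 ->
  let t g := inf [set q g | q in A] in
  sublinear t /\ (forall q g, A q -> B g -> t g <= q g).
Proof.
move=> Ap Atot [q0 Aq0] t.
have tq q g : A q -> B g -> t g <= q g.
  move=> Aq Bg; apply: ge_inf; last by exists q.
  exists (- p (- g)) => _ [r Ar <-]; have [sr rp] := Ap _ Ar.
  by rewrite (le_trans _ (sublinearN sr Bg))// lerN2 rp//; exact: BN.
have tinf a g : (forall q, A q -> a <= q g) -> a <= t g.
  by move=> h; apply: lb_le_inf; [exists (q0 g); exists q0|
    move=> _ [q Aq <-]; exact: h].
split=> //; split=> [g h Bg Bh|k g k0 Bg].
- rewrite -lerBlDl; apply: (tinf) => r Ar; rewrite lerBlDl -lerBlDr.
  apply: (tinf) => q Aq; rewrite lerBlDr.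
  have [qr|rq] := Atot _ _ Aq Ar.
  + rewrite (le_trans (tq _ _ Aq (BD Bg Bh)))//.
    by rewrite (le_trans ((Ap _ Aq).1.1 _ _ Bg Bh))// lerD2l qr.
  + rewrite (le_trans (tq _ _ Ar (BD Bg Bh)))//.
    by rewrite (le_trans ((Ap _ Ar).1.1 _ _ Bg Bh))// lerD2r rq.
- have h q : A q -> t (k *: g) <= k * q g.
    by move=> Aq; rewrite (le_trans (tq _ _ Aq (BZ _ Bg)))// (Ap _ Aq).1.2.
  have [k_0|kn0] := eqVneq k 0.
    by move: (h _ Aq0); rewrite k_0 !mul0r.
  have kp : 0 < k by rewrite lt_neqAle eq_sym kn0.
  by rewrite -ler_pdivrMl//; apply: (tinf) => q /h; rewrite ler_pdivrMl.
Qed.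

(* For fixed [h] the functional [g |-> inf_(s >= 0) q (g + s h) - s q h] is
   sublinear and below [q]; a minimal [q] equals it, which gives
   [q g + q h <= q (g + h)]. *)
Let minimal_additive q : sublinear q ->
    (forall r, sublinear r -> (forall g, B g -> r g <= q g) ->
      forall g, B g -> q g <= r g) ->
  forall g h, B g -> B h -> q (g + h) = q g + q h.
Proof.
move=> sq qmin g h Bg Bh; apply/eqP; rewrite eq_le sq.1//=.
pose D f := [set q (f + s *: h) - s * q h | s in [set s : R | 0 <= s]].
pose r f := inf (D f).
have rD f s : B f -> 0 <= s -> r f <= q (f + s *: h) - s * q h.
  move=> Bf s0; apply: ge_inf; last by exists s.
  exists (- q (- f)) => _ [u /= u0 <-].
  have := sq.1 (f + u *: h) (- f) (BD Bf (BZ _ Bh)) (BN Bf).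
  by rewrite addrAC subrr add0r (sublinearZ sq u0 Bh) => ?; lra.
have rinf f a : (forall s, 0 <= s -> a <= q (f + s *: h) - s * q h) ->
    a <= r f.
  move=> H; apply: lb_le_inf; last by move=> _ [s s0 <-]; exact: H.
  by exists (q (f + 0 *: h) - 0 * q h); exists 0 => //=.
have sr : sublinear r.
  split=> [f1 f2 B1 B2|k f k0 Bf].
    rewrite -lerBlDl; apply: (rinf) => s s0; rewrite lerBlDl -lerBlDr.
    apply: (rinf) => u u0; rewrite lerBlDr.
    have := rD (f1 + f2) (u + s) (BD B1 B2) (addr_ge0 u0 s0).
    have := sq.1 _ _ (BD B1 (BZ u Bh)) (BD B2 (BZ s Bh)).
    rewrite addrACA -scalerDl mulrDl; lra.
  have H s : 0 <= s -> r (k *: f) <= k * (q (f + s *: h) - s * q h).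
    move=> s0; have := rD (k *: f) (k * s) (BZ _ Bf) (mulr_ge0 k0 s0).
    rewrite -scalerA -scalerDr (sublinearZ sq k0 (BD Bf (BZ _ Bh))).
    lra.
  have [k_0|kn0] := eqVneq k 0.
    by move: (H _ (lexx 0)); rewrite k_0 !mul0r.
  have kp : 0 < k by rewrite lt_neqAle eq_sym kn0.
  by rewrite -ler_pdivrMl//; apply: (rinf) => s /H; rewrite ler_pdivrMl.
have := qmin r sr _ g Bg; have := rD g 1 Bg ler01; rewrite scale1r mul1r.
move=> rg /(_ _)/le_trans/(_ rg); rewrite lerBrDr; apply=> f Bf.
by have := rD f 0 Bf (lexx _); rewrite scale0r addr0 mul0r subr0.
Qed.

(** Zorn's lemma runs over the sublinear functionals below [p], not over partial linear extensions;
    [below] reverses the pointwise order, so its maximal elements are minimal functionals.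
    Additivity of such a [q] gives [q (- f) = - q f], hence homogeneity for negative scalars. *)
Theorem hahn_banach (p : V -> R) : sublinear p ->
  exists L : V -> R,
  [/\ forall g h, B g -> B h -> L (g + h) = L g + L h,
      forall k g, B g -> L (k *: g) = k * L g
    & forall g, B g -> L g <= p g].
Proof.
move=> sp.
pose Q := {q : V -> R | sublinear q /\ (forall g, B g -> q g <= p g)}.
pose below (q r : Q) : bool := `[< forall g, B g -> sval r g <= sval q g >].
have p_in : sublinear p /\ (forall g, B g -> p g <= p g) by split.
have [|||[q [sq qp]] qmin] := @ZL_preorder Q (exist _ p p_in) below.
- by move=> q; apply/asboolP.
- move=> r q s /asboolP qr /asboolP sq; apply/asboolP => g Bg.
  exact: le_trans (sq _ Bg) (qr _ Bg).
- move=> A Atot; have [A0|] := pselect (A !=set0); last first.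
    (* On the empty chain the infimum would take the default value [0], which need not lie below
       [p]; any element, here [p], bounds that chain. *)
    move=> nA; exists (exist _ p p_in) => s As; exfalso; apply: nA; by exists s.
  pose A' := [set sval q | q in A].
  have [|||st tq] := @chain_inf p A'.
  - by move=> _ [q Aq <-]; exact: (svalP q).
  - move=> _ _ [q Aq <-] [r Ar <-].
    by have [/asboolP|/asboolP] := Atot _ _ Aq Ar; [right|left].
  - by case: A0 => q Aq; exists (sval q), q.
  set t := (fun g => inf _) in st tq.
  have t_in : sublinear t /\ (forall g, B g -> t g <= p g).
    split=> // g Bg; have [q Aq] := A0.
    apply: le_trans (tq (sval q) g _ Bg) _; first by exists q.
    exact: (svalP q).2.
  exists (exist _ t t_in) => q Aq; apply/asboolP => g Bg /=.
  by apply: tq => //; exists q.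
have qD : forall g h, B g -> B h -> q (g + h) = q g + q h.
  apply: minimal_additive => // r sr rq g Bg.
  have r_in : sublinear r /\ (forall g, B g -> r g <= p g).
    by split=> // f Bf; rewrite (le_trans (rq _ Bf))// qp.
  suff /asboolP/(_ g Bg) : below (exist _ r r_in) (exist _ q (conj sq qp)) by [].
  by apply: qmin; apply/asboolP.
exists q; split=> // k g Bg.
have qN f : B f -> q (- f) = - q f.
  move=> Bf; apply/eqP; rewrite -addr_eq0 addrC -qD//; last exact: BN.
  by rewrite subrr (sublinear0 sq Bf).
have [k0|k0] := leP 0 k; first exact: sublinearZ.
rewrite -[k]opprK scaleNr qN; last exact: BZ.
by rewrite sublinearZ ?mulNr// oppr_ge0 ltW.
Qed.

End hahn_banach.

(** * Finitely additive means on bounded functions *)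

Definition bounded_real {R : realType} {T : Type} (g : T -> R) :=
  exists M, forall t, `|g t| <= M.

Section bounded_real_lemmas.
Context {R : realType} {T : Type}.
Implicit Types g h : T -> R.

Lemma bounded_realD g h : bounded_real g -> bounded_real h ->
  bounded_real (fun t => g t + h t).
Proof.
move=> [M gM] [N hN]; exists (M + N) => t.
by rewrite (le_trans (ler_normD _ _))// lerD.
Qed.

Lemma bounded_realZ k g : bounded_real g -> bounded_real (fun t => k * g t).
Proof.
by move=> [M gM]; exists (`|k| * M) => t; rewrite normrM ler_wpM2l.
Qed.

Lemma bounded_real_itv g a b : (forall t, a <= g t <= b) -> bounded_real g.
Proof.
move=> gab; exists (`|a| + `|b|) => t; have /andP[ag gb] := gab t.
rewrite ler_norml; have := ler_norm b; have := ler_norm (- a).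
have := normr_ge0 a; have := normr_ge0 b; rewrite normrN.
by move=> *; apply/andP; split; lra.
Qed.

Lemma bounded_real_bool (P : T -> bool) : bounded_real (fun t => (P t)%:R : R).
Proof. by apply: (@bounded_real_itv _ 0 1) => t; case: P; rewrite ?lexx ler01. Qed.

End bounded_real_lemmas.

(** This is integration against a finitely additive probability on all subsets of [T]. [L] is total,
    but its values on unbounded functions are unconstrained. *)
Definition is_mean {R : realType} {T : Type} (L : (T -> R) -> R) :=
  [/\ forall g h, bounded_real g -> bounded_real h ->
        L (fun t => g t + h t) = L g + L h,
      forall k g, bounded_real g -> L (fun t => k * g t) = k * L g,
      forall g, bounded_real g -> (forall t, 0 <= g t) -> 0 <= L g
    & L (fun=> 1) = 1].

Section mean_lemmas.
Context {R : realType} {T : Type} (L : (T -> R) -> R).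
Hypothesis meanL : is_mean L.

Lemma meanD g h : bounded_real g -> bounded_real h ->
  L (fun t => g t + h t) = L g + L h.
Proof. by case: meanL => + _ _ _; apply. Qed.

Lemma meanZ k g : bounded_real g -> L (fun t => k * g t) = k * L g.
Proof. by case: meanL => _ + _ _; apply. Qed.

Lemma mean_ge0 g : bounded_real g -> (forall t, 0 <= g t) -> 0 <= L g.
Proof. by case: meanL => _ _ + _; apply. Qed.

Lemma mean_le g h : bounded_real g -> bounded_real h ->
  (forall t, g t <= h t) -> L g <= L h.
Proof.
move=> bg bh gh; rewrite -subr_ge0 -mulN1r -meanZ// -meanD//; last first.
  exact: bounded_realZ.
apply: mean_ge0; first by apply: bounded_realD => //; exact: bounded_realZ.
by move=> t; rewrite mulN1r subr_ge0.
Qed.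

Lemma mean0 : L (fun=> 0) = 0.
Proof.
have b0 : bounded_real ((fun=> 0) : T -> R).
  by exists 0 => t; rewrite normr0.
rewrite -[RHS](mul0r (L (fun=> 0))) -(meanZ 0 b0); congr L.
by apply/funext => t; rewrite mul0r.
Qed.

(** [F] has countably many values, so the integral is a series over its fibres. By finite additivity
    a partial sum is [L] of [h \o G] cut down to finitely many values of [G], and positivity bounds
    it by [L (h \o G)]. *)
Lemma le_expectation_discrete d (O : measurableType d) (P : probability O R)
    (I : countType) (F : O -> I) (G : T -> I) (h : I -> R) :
    (forall i, measurable [set u | F u = i]) ->
    (forall i, P [set u | F u = i] = (L (fun t => (G t == i)%:R))%:E) ->
    bounded_real h -> (forall i, 0 <= h i) ->
  measurable_fun setT (h \o F) /\
  (\int[P]_u (h (F u))%:E <= (L (h \o G))%:E)%E.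
Proof.
move=> mF PF [M hM] h0.
pose D k := [set u | pickle (F u) = k].
have fibre k : (exists i : I, [/\ pickle i = k, D k = [set u | F u = i]
      & forall j : I, (pickle j == k) = (j == i)]) \/
    D k = set0 /\ (forall j : I, (pickle j == k) = false).
  have [[i ik]|nk] := pselect (exists i : I, pickle i = k); [left|right].
    have pE (j : I) : (pickle j == k) = (j == i).
      by rewrite -ik (inj_eq (pcan_inj pickleK)).
    exists i; split=> //; apply/seteqP; split=> u /=; rewrite /D/=.
      by move=> /eqP; rewrite pE => /eqP.
    by move=> ->.
  by split=> [|j]; [rewrite -subset0 => u Du|apply/eqP => jk]; apply: nk;
    [exists (F u)|exists j].
have mD k : measurable (D k) by have [[i [_ -> _]]|[-> _]] := fibre k.
have UD : \bigcup_k D k = setT.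
  by rewrite -subTset => u _; exists (pickle (F u)).
have mh : measurable_fun setT (h \o F).
  move=> _ Y mY; rewrite setTI.
  rewrite (_ : _ @^-1` Y = \bigcup_(k in [set k | exists i, pickle i = k /\ Y (h i)])
      D k).
    exact: bigcup_measurable.
  apply/seteqP; split=> [u Yu|u [k [i [ik Yi] Du]]]; first by
    exists (pickle (F u)) => //; exists (F u).
  by move: Du; rewrite /D/= -ik => /(pcan_inj pickleK) ->.
split=> //; have bG (Q : T -> bool) : bounded_real (fun t => h (G t) * (Q t)%:R).
  apply: (@bounded_real_itv _ _ _ 0 M) => t; rewrite mulr_ge0//=.
  rewrite (le_trans _ (hM (G t)))// (le_trans _ (ler_norm _))//.
  by rewrite ler_piMr//; case: (Q t).
have intD k : (\int[P]_(u in D k) (h (F u))%:E =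
    (L (fun t => h (G t) * (pickle (G t) == k)%:R))%:E)%E.
  have [[i [ik Dk pE]]|[Dk pE]] := fibre k; last first.
    rewrite Dk integral_set0; congr EFin; rewrite -[LHS]mean0; congr L.
    by apply/funext => t; rewrite pE mulr0.
  rewrite Dk (eq_integral (cst (h i)%:E)); last by move=> u; rewrite inE/= => ->.
  transitivity ((h i)%:E * P [set u | F u = i])%E; first exact: integral_cst.
  rewrite PF -EFinM; congr EFin.
  rewrite -meanZ; last exact: bounded_real_bool.
  congr L; apply/funext => t; rewrite pE.
  by case: eqP => [->|]; rewrite ?mulr0.
have psum N : (\sum_(0 <= k < N) \int[P]_(u in D k) (h (F u))%:E =
    (L (fun t => h (G t) * (pickle (G t) < N)%N%:R))%:E)%E.
  elim: N => [|N IH].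
    rewrite big_geq//; congr EFin; rewrite -[LHS]mean0; congr L.
    by apply/funext => t; rewrite ltn0 mulr0.
  rewrite big_nat_recr//= IH intD -EFinD -meanD//; congr (L _)%:E.
  apply/funext => t; rewrite -mulrDr -natrD ltnS; congr (_ * _%:R).
  by case: ltngtP.
rewrite -UD ge0_integral_bigcup//; first last.
- by move=> k l _ _ [u [<- <-]].
- by move=> u _; rewrite lee_fin.
- by rewrite UD; exact/measurable_EFinP.
apply: lime_le.
  by apply: is_cvg_nneseries => k _ _; apply: integral_ge0 => u _; rewrite lee_fin.
apply: nearW => N; rewrite psum lee_fin; apply: mean_le => //.
  by exists M => t; exact: hM.
by move=> t /=; rewrite ler_piMr//; case: (_ < _)%N.
Qed.

End mean_lemmas.

(** * A Lebesgue-random branch with prescribed laws of histories *)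

(* The first [n] values of [s], most recent first. *)
Fixpoint history (s : nat -> nat) n : seq nat :=
  if n is m.+1 then s m :: history s m else [::].

Lemma size_history s n : size (history s n) = n.
Proof. by elim: n => //= n ->. Qed.

Section unit_lebesgue.
Context {R : realType}.
Local Notation mu := (@lebesgue_measure R).

Definition unit_lebesgue : set (measurableTypeR R) -> \bar R :=
  mrestr mu (measurable_itv `[0, 1[).

HB.instance Definition _ := Measure.on unit_lebesgue.

Let unit_lebesgue_setT : unit_lebesgue setT = 1%E.
Proof.
by rewrite /unit_lebesgue /mrestr setTI lebesgue_measure_itv/= lte_fin ltr01 oppr0 adde0.
Qed.

HB.instance Definition _ :=
  @Measure_isProbability.Build _ _ R unit_lebesgue unit_lebesgue_setT.

End unit_lebesgue.

Section random_branch.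
Context {R : realType} {T : Type}.
Variables (L : (T -> R) -> R) (idx : nat -> T -> nat).
Hypothesis meanL : is_mean L.
Hypothesis tail0 : forall l (e : R), 0 < e ->
  exists K, L (fun t => (K <= idx l t)%N%:R) < e.

Let hist t := history (idx^~ t).
Let mass (w : seq nat) := L (fun t => (hist t (size w) == w)%:R).

(** The history [w] is assigned the half-open interval of length [mass w] starting at [left_end w].
    Inside it the intervals of the extensions [k :: w] lie side by side in increasing order of
    [k]. *)
Fixpoint left_end w : R :=
  if w is k :: v then left_end v + \sum_(j < k) mass ((j : nat) :: v) else 0.

Let mass_ge0 w : 0 <= mass w.
Proof. by apply: (mean_ge0 meanL); [exact: bounded_real_bool|move=> t; exact: ler0n]. Qed.

Let mass_nil : mass [::] = 1.
Proof. by case: meanL. Qed.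

Let sum_mass w K : \sum_(j < K) mass ((j : nat) :: w) =
  L (fun t => ((hist t (size w) == w) && (idx (size w) t < K)%N)%:R).
Proof.
elim: K => [|K IH].
  rewrite big_ord0 -(mean0 meanL); congr L; apply/funext => t; by rewrite ltn0 andbF.
rewrite big_ord_recr/= IH /mass -(meanD meanL); [|exact: bounded_real_bool..].
congr L; apply/funext => t /=; rewrite eqseq_cons ltnS -natrD.
congr (_ %:R); case: (hist t (size w) == w); rewrite ?andbT ?andbF //=.
by case: ltngtP.
Qed.

Let sum_mass_le w K : \sum_(j < K) mass ((j : nat) :: w) <= mass w.
Proof.
rewrite sum_mass; apply: (mean_le meanL); [exact: bounded_real_bool..|].
by move=> t; rewrite ler_nat; case: (_ == w) => //=; case: (_ < _)%N.
Qed.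

(** The extensions of [w] exhaust its mass: [tail0] makes the mass of the indices from [K] on
    arbitrarily small, which stands in for countable additivity of [L]. *)
Let sum_mass_gt w r : r < mass w -> exists K, r < \sum_(j < K) mass ((j : nat) :: w).
Proof.
move=> rm; have [K] := @tail0 (size w) (mass w - r) (ltac:(by rewrite subr_gt0)).
move=> LK; exists K; rewrite sum_mass.
suff : mass w <= L (fun t => ((hist t (size w) == w) && (idx (size w) t < K)%N)%:R)
    + L (fun t => (K <= idx (size w) t)%N%:R) by move=> ?; lra.
rewrite -(meanD meanL); [|exact: bounded_real_bool..].
apply: (mean_le meanL); first exact: bounded_real_bool.
  by apply: bounded_realD; exact: bounded_real_bool.
move=> t; rewrite -natrD ler_nat [(K <= _)%N]leqNgt.
by case: (_ == w) => //=; case: (idx _ t < K)%N.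
Qed.

Let in_cell w u := (left_end w <= u) && (u < left_end w + mass w).

Let left_endS k w : left_end (k :: w) + mass (k :: w) =
  left_end w + \sum_(j < k.+1) mass ((j : nat) :: w).
Proof. by rewrite big_ord_recr/= addrA. Qed.

Let in_cell_behead k w u : in_cell (k :: w) u -> in_cell w u.
Proof.
rewrite /in_cell left_endS => /andP[lu ul]; apply/andP; split.
  by rewrite (le_trans _ lu)//= lerDl sumr_ge0.
by rewrite (lt_le_trans ul)// lerD2l sum_mass_le.
Qed.

Let in_cell_unit w u : in_cell w u -> 0 <= u < 1.
Proof.
elim: w => [|k w IH]; first by rewrite /in_cell/= mass_nil add0r.
by move/in_cell_behead.
Qed.

Let in_cell_cons w u : in_cell w u -> exists k, in_cell (k :: w) u.
Proof.
move=> /andP[lu ul]; rewrite addrC -ltrBlDr in ul.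
(* If [K.+1] is the least number of extensions whose total length reaches past [u], then the last of
   them contains [u]. Zero extensions never suffice, since [u] is not left of the cell. *)
have ex := sum_mass_gt ul; pose k := ex_minn ex.
rewrite -/k; move: (erefl k); rewrite {2}/k; case: ex_minnP => -[|K].
  by rewrite big_ord0 subr_lt0 ltNge lu.
move=> uK min _; exists K; rewrite /in_cell left_endS.
rewrite addrC -ltrBlDr uK andbT /= -lerBrDl leNgt; apply/negP => /min.
by rewrite ltnn.
Qed.

Let left_end_lt k k' w u : in_cell (k :: w) u -> in_cell (k' :: w) u ->
  (k' <= k)%N.
Proof.
rewrite /in_cell left_endS /= => /andP[_ uk] /andP[k'u _].
rewrite leqNgt; apply/negP => kk'; have := le_lt_trans k'u uk.
rewrite ltrD2l ltNge => /negP; apply.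
by rewrite !(big_ord_widen _ (fun j => mass ((j : nat) :: w)) kk')
  [leLHS]big_mkcond; apply: ler_sum => i _; case: ifP.
Qed.

Let in_cell_inj k k' w u : in_cell (k :: w) u -> in_cell (k' :: w) u -> k = k'.
Proof.
move=> H H'; apply/eqP.
by rewrite eqn_leq (left_end_lt H' H) (left_end_lt H H').
Qed.

Fixpoint branch u n : seq nat :=
  if n is m.+1 then xget 0%N [set k | in_cell (k :: branch u m) u] :: branch u m
  else [::].

Let size_branch u n : size (branch u n) = n.
Proof. by elim: n => //= n ->. Qed.

Let in_cell_branch u n : 0 <= u < 1 -> in_cell (branch u n) u.
Proof.
move=> u01; elim: n => [|n IH]; first by rewrite /in_cell/= mass_nil add0r.
have [k ku] := in_cell_cons IH.
exact: (@xgetPex _ 0%N [set k | in_cell (k :: branch u n) u] (ex_intro _ k ku)).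
Qed.

Let branch_uniq w u : in_cell w u -> branch u (size w) = w.
Proof.
elim: w => //= k w IH kwu; have wu := IH (in_cell_behead kwu); rewrite wu.
congr cons; apply: (@in_cell_inj _ _ w u) => //.
exact: (@xgetPex _ 0%N [set k | in_cell (k :: w) u] (ex_intro _ k kwu)).
Qed.

(** Points outside [[0, 1)] follow the branch of [0], so that the last clause of [random_branch]
    holds for every real [u] and not only almost everywhere. *)
Let clamp (u : R) := if 0 <= u < 1 then u else 0.

Let clamp01 u : 0 <= clamp u < 1.
Proof. by rewrite /clamp; case: ifPn => // _; rewrite lexx ltr01. Qed.

(** Within [[0, 1)] the event that [u] produces the history [w] is the cell of [w], an interval of
    length [mass w]. The last clause transfers facts about the indices of a single [t] to the random
    indices. *)
Lemma random_branch : exists B : nat -> measurableTypeR R -> nat,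
  [/\ forall n w, measurable [set u | history (B^~ u) n = w],
      forall n w, unit_lebesgue [set u | history (B^~ u) n = w] =
        (L (fun t => (history (idx^~ t) n == w)%:R))%:E
    & forall n u, exists t, history (idx^~ t) n = history (B^~ u) n].
Proof.
pose B n u := head 0%N (branch (clamp u) n.+1).
have BE n u : history (B^~ u) n = branch (clamp u) n.
  by elim: n => //= n ->.
have cellE w : [set u | branch (clamp u) (size w) = w] `&` `[0, 1[ =
    `[left_end w, left_end w + mass w[%classic.
  apply/seteqP; split=> u /=; rewrite !in_itv/=.
    move=> [<- u01]; have := in_cell_branch (size w) u01.
    by rewrite /clamp u01.
  move=> wu; have u01 := in_cell_unit wu; split=> //.
  by rewrite /clamp u01; exact: branch_uniq.
have emptyE n w : size w != n -> [set u | branch (clamp u) n = w] = set0.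
  by move=> wn; rewrite -subset0 => u /= h; move: wn; rewrite -h size_branch eqxx.
have mcell n w : measurable [set u : measurableTypeR R | branch (clamp u) n = w].
  have [<-|/emptyE ->//] := eqVneq (size w) n.
  rewrite -(setIT [set u | _]) -(setUv `[0 : R, 1[%classic) setIUr.
  apply: measurableU; first by rewrite cellE; exact: measurable_itv.
  have [h|h] := eqVneq (branch 0 (size w)) w.
    rewrite setIidr; first by apply: measurableC; exact: measurable_itv.
    by move=> u /=; rewrite in_itv/= /clamp => /negP/negbTE ->.
  rewrite [X in measurable X](_ : _ = set0)//; rewrite -subset0 => u /= [].
  by rewrite in_itv/= /clamp => + /negP/negbTE u01; rewrite u01; move/eqP: h.
exists B; split=> [n w|n w|n u].
- by under eq_set do rewrite BE.
- under eq_set do rewrite BE.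
  have [<-|wn] := eqVneq (size w) n.
    rewrite /unit_lebesgue/= /mrestr cellE lebesgue_measure_itv/= lte_fin.
    rewrite -EFinB addrAC subrr add0r; case: ifPn => //.
    rewrite -leNgt gerDl => m0; congr EFin; apply/eqP.
    by rewrite eq_le mass_ge0.
  rewrite emptyE// measure0; congr EFin; rewrite -[LHS](mean0 meanL).
  congr L; apply/funext => t.
  by case: eqP => // h; move: wn; rewrite -h size_history eqxx.
(* A history attained by no [t] has mass [0], so its half-open cell is empty; yet that cell contains
   [clamp u]. *)
- rewrite BE; apply/not_existsP => H.
  have /andP[] := in_cell_branch n (clamp01 u); rewrite leNgt => /negP + lt.
  apply; suff -> : left_end (branch (clamp u) n) =
    left_end (branch (clamp u) n) + mass (branch (clamp u) n) by [].
  rewrite -[LHS]addr0 -(mean0 meanL); congr (_ + L _); apply/funext => t.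
  by rewrite size_branch; case: eqP => // h; case: (H t).
Qed.

End random_branch.

(** * Regularity and tightness of finite Borel measures *)

Section small_sets.
Context d (T : measurableType d) (R : realType).
Variable nu : {finite_measure set T -> \bar R}.

Lemma decreasing_to_empty_small (B : nat -> set T) (e : R) : 0 < e ->
    (forall n, measurable (B n)) ->
    (forall n m, (n <= m)%N -> B m `<=` B n) ->
    \bigcap_n B n = set0 ->
  exists n, (nu (B n) < e%:E)%E.
Proof.
move=> e0 mB decB B0.
have : (nu \o B) n @[n --> \oo] --> 0%E.
  have <- : nu (\bigcap_n B n) = 0%E by rewrite B0 measure0.
  apply: nonincreasing_cvg_mu => //.
  - by rewrite -ge0_fin_numE//; exact: fin_num_measure.
  - exact: bigcapT_measurable.
  - by move=> m n mn; apply/subsetPset/decB.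
move/fine_cvgP => [_ /cvgrPdist_lt/(_ _ e0)[N _ H]].
exists N; have := H N (leqnn N).
rewrite /= sub0r normrN ger0_norm ?fine_ge0// => He.
by rewrite -(fineK (fin_num_measure nu _ (mB N))) lte_fin.
Qed.

Lemma bigcup_geometric_small (B : nat -> set T) (e : R) : 0 <= e ->
    (forall n, measurable (B n)) ->
    (forall n, (nu (B n) <= (e / (2 ^ n.+1)%:R)%:E)%E) ->
  (nu (\bigcup_n B n) <= e%:E)%E.
Proof.
move=> e0 mB Be; apply: (@le_trans _ _ (\sum_(n <oo) nu (B n))%E).
  by apply: measure_sigma_subadditive => //; exact: bigcup_measurable.
apply: le_trans (epsilon_trick0 xpredT e0).
by apply: lee_nneseries => // n _; exact: Be.
Qed.

End small_sets.

Lemma harmonic_lt {R : realType} (e : R) : 0 < e ->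
  exists N, forall n, (N <= n)%N -> n.+1%:R^-1 < e.
Proof.
move=> e0; have /cvgrPdist_lt/(_ _ e0)[N _ H] := @cvg_harmonic R.
exists N => n Nn; have := H n Nn; rewrite /= sub0r normrN /harmonic/=.
by rewrite ger0_norm// invr_ge0.
Qed.

Section polish_space.
Context {R : realType} {E : ptopologicalType} (dist : E -> E -> R).
Hypothesis dist_metric : is_metric dist.
Hypothesis dist_compat : metric_compatible dist.

Let dist_xx x : dist x x = 0. Proof. by case: dist_metric. Qed.
Let distC x y : dist x y = dist y x. Proof. by case: dist_metric. Qed.
Let dist_triangle x y z : dist x z <= dist x y + dist y z.
Proof. by case: dist_metric. Qed.

Lemma open_dist_ball x r : open [set y | dist x y < r].
Proof.
rewrite openE => y /= xy; apply/dist_compat; exists (r - dist x y).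
  by rewrite subr_gt0.
by move=> z /= yz; have := dist_triangle x y z => ?; lra.
Qed.

Lemma closed_dist_ball x r : closed [set y | dist x y <= r].
Proof.
rewrite -openC openE => y /= /negP; rewrite -ltNge => xy.
apply/dist_compat; exists (dist x y - r); first by rewrite subr_gt0.
move=> z /= yz; apply/negP; rewrite -ltNge.
by have := dist_triangle x z y; rewrite (distC z y) => ?; lra.
Qed.

Lemma open_borel (U : set E) : open U -> measurable (U : set (borel E)).
Proof. by move=> oU; exact: sub_sigma_algebra. Qed.

Lemma closed_borel (F : set E) : closed F -> measurable (F : set (borel E)).
Proof.
by rewrite -openC => /open_borel oF; rewrite -(setCK F); exact: measurableC.
Qed.

Definition nbhd (F : set E) n := \bigcup_(x in F) [set y | dist x y < n.+1%:R^-1].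

Lemma open_nbhd F n : open (nbhd F n).
Proof. by apply: bigcup_open => x _; exact: open_dist_ball. Qed.

Lemma nbhd_le F n m : (n <= m)%N -> nbhd F m `<=` nbhd F n.
Proof.
move=> nm y [x Fx /= xy]; exists x => //=; apply: lt_le_trans xy _.
by rewrite lef_pV2 ?posrE// ler_nat.
Qed.

Lemma sub_nbhd F n : F `<=` nbhd F n.
Proof. by move=> x Fx; exists x => //=; rewrite dist_xx. Qed.

Lemma bigcap_nbhd F : closed F -> \bigcap_n nbhd F n = F.
Proof.
move=> cF; apply/seteqP; split=> [y Fy|y Fy n _]; last exact: sub_nbhd.
apply: cF => A /dist_compat[e e0 eA].
have [n /(_ n (leqnn n)) ne] := harmonic_lt e0.
have [x Fx xy] := Fy n I; exists x; split=> //; apply: eA => /=.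
by rewrite distC (lt_trans xy).
Qed.

Section regularity.
Variable nu : {finite_measure set (borel E) -> \bar R}.

Let closed_regular (A : set (borel E)) := forall e : R, 0 < e ->
  exists F : set (borel E), [/\ closed (F : set E), F `<=` A & (nu (A `\` F) < e%:E)%E].

(** The approximants are the complements of shrinking neighbourhoods of the complement of [U]. That
    complement being closed, what they miss of [U] decreases to the empty set. *)
Let regular_open (U : set E) : open U -> closed_regular U.
Proof.
move=> oU e e0; have cU : closed (~` U) by exact: open_closedC.
have [|||n ne] :=
    @decreasing_to_empty_small _ _ _ nu (fun n => U `&` nbhd (~` U) n) e e0.
- by move=> n; apply: open_borel; apply: openI => //; exact: open_nbhd.
- by move=> n m nm; apply: setIS; exact: nbhd_le.
- rewrite -subset0 => x H; have [Ux _] := H 0%N I; suff : (~` U) x by exact.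
  by rewrite -(bigcap_nbhd cU) => n _; have [] := H n I.
exists (~` nbhd (~` U) n); split.
- exact/open_closedC/open_nbhd.
- by rewrite -[X in _ `<=` X]setCK; apply: subsetC; exact: sub_nbhd.
- by rewrite setDE setCK.
Qed.

(** A countable union of closed sets need not be closed, so only the first [N] are kept. Half of [e]
    pays for this truncation, the other half for approximating all the [A n]. *)
Let regular_bigcup (A : nat -> set (borel E)) :
    (forall n, measurable (A n)) -> (forall n, closed_regular (A n)) ->
  closed_regular (\bigcup_n A n).
Proof.
move=> mA rA e e0.
have e2 n : 0 < e / 2 / (2 ^ n.+1)%:R :> R.
  by rewrite divr_gt0 ?divr_gt0// ltr0n expn_gt0.
have [F FP] := choice (fun n => rA n _ (e2 n)).
have mF n : measurable (F n) by have [/closed_borel] := FP n.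
pose G N := \bigcup_(n in [set n | (n < N)%N]) F n.
have mG N : measurable (G N) by exact: bigcup_measurable.
have mUF : measurable (\bigcup_n F n) by exact: bigcup_measurable.
have [|||N HN] := @decreasing_to_empty_small _ _ _ nu
    (fun N => (\bigcup_n F n) `\` G N) (e / 2) (divr_gt0 e0 (ltr0n _ 2)).
- by move=> n; exact: measurableD.
- move=> n m nm; apply: setDS => x [k /= kn Fx]; exists k => //=.
  exact: leq_trans nm.
- rewrite -subset0 => x H; have [[k _ Fkx] _] := H 0%N I.
  by have [_] := H k.+1 I; apply; exists k => /=.
exists (G N); split.
- by apply: closed_bigcup => [|n _]; [exact: finite_II|have [] := FP n].
- by move=> x [n _ Fx]; exists n => //; have [_ + _] := FP n; apply.
pose U := \bigcup_n (A n `\` F n); pose V := \bigcup_n F n `\` G N.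
have mAF n : measurable (A n `\` F n) by exact: measurableD.
have mU : measurable U by exact: bigcup_measurable.
have mV : measurable V by exact: measurableD.
apply: (@le_lt_trans _ _ (nu (U `|` V))).
  apply: le_measure; rewrite ?inE.
  - by apply: measurableD => //; exact: bigcup_measurable.
  - exact: measurableU.
  move=> x [[n _ Ax] nG]; have [Fx|nFx] := pselect ((\bigcup_n F n) x).
    by right.
  by left; exists n => //; split=> // Fx; apply: nFx; exists n.
apply: (le_lt_trans (measureU2 nu mU mV)); rewrite (splitr e) EFinD.
apply: lee_ltD; last exact: HN.
  exact: fin_num_measure.
apply: bigcup_geometric_small => //; first by rewrite divr_ge0 ?ltW.
by move=> n; apply: ltW; have [] := FP n.
Qed.

Let regular_bigcap (A : nat -> set (borel E)) :
    (forall n, measurable (A n)) -> (forall n, closed_regular (A n)) ->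
  closed_regular (\bigcap_n A n).
Proof.
move=> mA rA e e0.
have e2 n : 0 < e / 2 / (2 ^ n.+1)%:R :> R.
  by rewrite divr_gt0 ?divr_gt0// ltr0n expn_gt0.
have [F FP] := choice (fun n => rA n _ (e2 n)).
have mF n : measurable (F n) by have [/closed_borel] := FP n.
have mAF n : measurable (A n `\` F n) by exact: measurableD.
exists (\bigcap_n F n); split.
- by apply: closed_bigI => n _; have [] := FP n.
- by move=> x Fx n _; have [_ + _] := FP n; apply; exact: Fx.
apply: (@le_lt_trans _ _ (nu (\bigcup_n (A n `\` F n)))).
  apply: le_measure; rewrite ?inE.
  - by apply: measurableD; exact: bigcapT_measurable.
  - exact: bigcup_measurable.
  move=> x [Ax /existsNP[n /not_implyP[_ nFx]]].
  by exists n => //; split=> //; exact: Ax.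
apply: (@le_lt_trans _ _ (e / 2)%:E); last by rewrite lte_fin; lra.
apply: bigcup_geometric_small => //; first by rewrite divr_ge0 ?ltW.
by move=> n; apply: ltW; have [] := FP n.
Qed.

(** The Borel sets that are regular together with their complements form a sigma-algebra containing
    the open sets. Carrying the complement along is why a countable union needs both
    [regular_bigcup] and [regular_bigcap]. *)
Lemma closed_inner_regular (A : set (borel E)) (e : R) : measurable A -> 0 < e ->
  exists F : set (borel E), [/\ closed (F : set E), F `<=` A & (nu (A `\` F) < e%:E)%E].
Proof.
move=> mA e0; suff [_ [+ _]] : measurable A /\
    closed_regular A /\ closed_regular (~` A) by apply.
pose C := [set A : set (borel E) | measurable A /\
  closed_regular A /\ closed_regular (~` A)].
suff : <<s @open E >> `<=` C by apply.
apply: smallest_sub; first split.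
- split=> //; split=> e' e'0; [exists set0|exists setT]; split=> //.
  + exact: (@closed0 E).
  + by rewrite setD0 measure0 lte_fin.
  + by rewrite setC0.
  + by rewrite setDT measure0 lte_fin.
- move=> B [mB [rB rCB]]; rewrite setTD.
  by split; [exact: measurableC|rewrite setCK].
- move=> B BC; have mB n : measurable (B n : set (borel E)) by have [] := BC n.
  split; first exact: bigcup_measurable.
  rewrite setC_bigcup; split.
    by apply: regular_bigcup => // n; have [_ []] := BC n.
  apply: regular_bigcap => n; first exact: measurableC.
  by have [_ []] := BC n.
- move=> U oU; split; first exact: open_borel.
  split; first exact: regular_open.
  move=> e' e'0; exists (~` U); split=> //; first exact: open_closedC.
  by rewrite setDv measure0 lte_fin.
Qed.

End regularity.

Lemma cvg_dist_lt (u : nat -> E) (l : E) e : u @ \oo --> l -> 0 < e ->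
  exists N, forall n, (N <= n)%N -> dist l (u n) < e.
Proof.
move=> ul e0; have nl : nbhs l [set y | dist l y < e].
  by apply/dist_compat; exists e.
have [N _ H] := ul _ nl.
by exists N => n; exact: H.
Qed.

Hypothesis dist_complete : metric_complete dist.

Lemma cauchy_harmonic_cvg (u : nat -> E) :
    (forall m n, dist (u m) (u n) <= m.+1%:R^-1 + n.+1%:R^-1) ->
  exists l : E, u @ \oo --> l.
Proof.
move=> uC; apply: dist_complete => e e0.
have [N HN] := harmonic_lt (divr_gt0 e0 (ltr0n _ 2)).
exists N => m n Nm Nn; apply: le_lt_trans (uC m n) _.
by rewrite (splitr e) ltrD// HN.
Qed.

Let ultra_finite_cover (F : set_system E) (B : nat -> set E) N :
    UltraFilter F -> F (\bigcup_(i in [set i | (i < N)%N]) B i) ->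
  exists i, F (B i).
Proof.
move=> FU; elim: N => [|N IH] FN.
  by exfalso; apply: (@filter_not_empty _ F); apply: filterS FN => x [].
have [FB|FB] := in_ultra_setVsetC (B N) FU; first by exists N.
apply: IH; apply: filterS (filterI FN FB) => x [[i /=]].
rewrite ltnS leq_eqVlt => /predU1P[->//|iN] Bi _.
by exists i.
Qed.

(** An ultrafilter on [K] contains a ball of each radius [n.+1^-1]. Any two of these balls meet, so
    their centres form a Cauchy sequence, and its limit is a limit of the ultrafilter. *)
Lemma totally_bounded_compact (xs : nat -> E) (K : set E) : closed K ->
    (forall n, exists N, K `<=`
       \bigcup_(i in [set i | (i < N)%N]) [set y | dist (xs i) y <= n.+1%:R^-1]) ->
  compact K.
Proof.
move=> cK tbK; rewrite compact_ultra => F FU FK /=.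
have /choice[I FI] n : exists i, F [set y | dist (xs i) y <= n.+1%:R^-1].
  have [N KN] := tbK n; apply: (@ultra_finite_cover _ _ N) => //.
  exact: filterS FK.
have [m n|l ul] := @cauchy_harmonic_cvg (xs \o I).
  have [y [ym yn]] := filter_ex (filterI (FI m) (FI n)).
  rewrite (le_trans (dist_triangle _ y _))// lerD//.
  by rewrite distC.
have Fl : F --> l.
  move=> A /dist_compat[e e0 eA].
  have e2 : 0 < e / 2 by rewrite divr_gt0.
  have [N1 H1] := harmonic_lt e2; have [N2 H2] := cvg_dist_lt ul e2.
  pose n := maxn N1 N2; apply: filterS (FI n) => y /= yn; apply: eA => /=.
  rewrite (le_lt_trans (dist_triangle _ (xs (I n)) _))// (splitr e) ltrD//.
    by apply: H2; exact: leq_maxr.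
  by rewrite (le_lt_trans yn)// H1// leq_maxl.
exists l; split=> //; apply: cK => A /Fl FA.
by have [y] := filter_ex (filterI FK FA); exists y.
Qed.

Lemma separable_dense_sequence : separable E ->
  exists xs : nat -> E, forall y e, 0 < e -> exists n, dist (xs n) y < e.
Proof.
move=> [S /countable_injP[f finj] dS].
exists (fun n => xget point [set s | S s /\ f s = n]) => y e e0.
have [||s [ys Ss]] := dS [set x | dist y x < e].
- by exists y => /=; rewrite dist_xx.
- exact: open_dist_ball.
exists (f s); case: xgetP => [z _ [Sz fz]|/(_ s)]; last by case.
by rewrite (_ : z = s) 1?distC//; apply: finj; rewrite ?inE.
Qed.

(** Ulam's argument: at scale [n], finitely many balls about the dense sequence miss less than
    [e / 2 / 2 ^ n.+1]. Their intersection over all scales is totally bounded, and it is cut with a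
    closed approximant of [A]. *)
Lemma compact_inner_regular (nu : {finite_measure set (borel E) -> \bar R})
    (xs : nat -> E) (A : set (borel E)) (e : R) :
    (forall y e, 0 < e -> exists n, dist (xs n) y < e) ->
    measurable A -> 0 < e ->
  exists K : set (borel E), [/\ compact (K : set E), closed (K : set E), K `<=` A &
    (nu (A `\` K) < e%:E)%E].
Proof.
move=> xs_dense mA e0.
have e2 : 0 < e / 2 by rewrite divr_gt0.
have e4 n : 0 < e / 2 / (2 ^ n.+1)%:R :> R.
  by rewrite divr_gt0// ltr0n expn_gt0.
have [F [cF FA nuF]] := closed_inner_regular nu mA e2.
pose C n N : set (borel E) :=
  \bigcup_(i in [set i | (i < N)%N]) [set y | dist (xs i) y <= n.+1%:R^-1].
have cC n N : closed (C n N : set E).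
  by apply: closed_bigcup => [|i _]; [exact: finite_II|exact: closed_dist_ball].
have mC n N : measurable (C n N) by exact: closed_borel.
have /choice[N HN] n : exists N, (nu (~` C n N) < (e / 2 / (2 ^ n.+1)%:R)%:E)%E.
  apply: (@decreasing_to_empty_small _ _ _ nu (fun N => ~` C n N) _ (e4 n)).
  - by move=> N; exact: measurableC.
  - move=> N M NM; apply: subsetC => y [i /= iN yi]; exists i => //=.
    exact: leq_trans NM.
  - rewrite -subset0 => y H.
    have [|i yi] := xs_dense y n.+1%:R^-1; first by rewrite invr_gt0.
    by apply: (H i.+1 I); exists i => //=; exact: ltW.
pose K : set (borel E) := \bigcap_n C n (N n).
have cK : closed (K : set E) by exact: closed_bigI.
have KK : compact (K : set E).
  apply: (totally_bounded_compact (xs := xs) cK) => n; exists (N n).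
  by move=> y; apply.
exists (F `&` K); split.
- by rewrite setIC; exact: compact_closedI.
- exact: closedI.
- by move=> y [/FA].
have mF := closed_borel cF; have mK := closed_borel cK.
have mAF : measurable (A `\` F) by exact: measurableD.
have mKC : measurable (~` K) by exact: measurableC.
apply: (@le_lt_trans _ _ (nu ((A `\` F) `|` ~` K))).
  apply: le_measure; rewrite ?inE.
  - by apply: measurableD => //; exact: measurableI.
  - exact: measurableU.
  move=> y [Ay nFK]; have [Fy|nFy] := pselect (F y); last by left.
  by right=> Ky; apply: nFK.
apply: (le_lt_trans (measureU2 nu mAF mKC)); rewrite (splitr e) EFinD.
apply: lte_leD => //; first exact: fin_num_measure.
rewrite /K setC_bigcap.
apply: bigcup_geometric_small => //; first exact: ltW.
- by move=> n; exact: measurableC.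
- by move=> n; exact: ltW.
Qed.

End polish_space.

(** * Weak duality for finitely valued functions *)

Lemma closed_compact_section {R : realType} {E : ptopologicalType}
    (c : E -> E -> R) (K : set E) r :
    lower_semicontinuous (fun p : E * E => (c p.1 p.2)%:E) -> compact K ->
  closed [set x | exists2 y, K y & c x y <= r].
Proof.
move=> c_lsc /compact_near_coveringP cK.
rewrite -openC openE => x /= xK.
(* Tube lemma: lower semicontinuity keeps [r < c] near each [(x, y)], and compactness of [K] makes
   the neighbourhood of [x] independent of [y]. *)
have : \forall x' \near x, forall y, K y -> r < c x' y.
  apply: cK => y Ky; have [|V [[A B]/= [xA yB] ABV] HV] := c_lsc (x, y) r.
    by rewrite lte_fin ltNge; apply/negP => cxy; apply: xK; exists y.
  exists (B, A) => //= -[y' x'] /= [By' Ax'].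
  by have := HV (x', y') (ABV (x', y') (conj Ax' By')); rewrite lte_fin.
by apply: filterS => x' H [y /H]; rewrite ltNge => /negP.
Qed.

Lemma measurable_fun_lt d (T : measurableType d) (R : realType) (f : T -> R) :
  (forall r, measurable [set x | f x < r]) -> measurable_fun setT f.
Proof.
move=> mf mT; apply: (measurability _ (RGenInftyO.measurableE R)) => //.
move=> _ [_ [r ->] <-]; rewrite setTI (_ : _ @^-1` _ = [set x | f x < r])//.
Qed.

Section finitely_valued.
Context d (T : measurableType d) (R : realType).
Implicit Types f g : T -> R.

Definition finitely_valued f :=
  measurable_fun setT f /\ exists s : seq R, forall x, f x \in s.

Lemma finitely_valued_cst k : finitely_valued (cst k).
Proof. by split=> //; exists [:: k] => x; rewrite inE. Qed.

Lemma finitely_valued_indic (A : set T) : measurable A ->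
  finitely_valued (fun x => (x \in A)%:R).
Proof.
move=> mA; split; first exact: measurable_indic.
by exists [:: 0; 1] => x; rewrite !in_cons; case: (x \in A); rewrite eqxx ?orbT.
Qed.

Lemma finitely_valuedD f g : finitely_valued f -> finitely_valued g ->
  finitely_valued (fun x => f x + g x).
Proof.
move=> [mf [s fs]] [mg [t gt]]; split; first exact: measurable_funD.
by exists [seq a + b | a <- s, b <- t] => x; apply: allpairs_f.
Qed.

Lemma finitely_valuedZ k f : finitely_valued f ->
  finitely_valued (fun x => k * f x).
Proof.
move=> [mf [s fs]]; split; first exact: measurable_funM.
by exists [seq k * a | a <- s] => x; apply: map_f.
Qed.

Lemma finitely_valued_bounded f : finitely_valued f -> bounded_real f.
Proof.
move=> [_ [s fs]]; exists (\sum_(a <- s) `|a|) => x.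
by rewrite (big_rem _ (fs x))/= lerDl sumr_ge0.
Qed.

Lemma finitely_valued_integrable (P : {finite_measure set T -> \bar R}) f :
  finitely_valued f -> P.-integrable setT (EFin \o f).
Proof.
move=> ff; have [M fM] := finitely_valued_bounded ff.
apply: le_integrable (finite_measure_integrable_cst P M measurableT) => //.
  by apply/measurable_EFinP; case: ff.
move=> x _ /=; rewrite lee_fin (le_trans (fM x))//; exact: ler_norm.
Qed.

End finitely_valued.

Section weak_duality.
Context {R : realType} {E : ptopologicalType} (dist : E -> E -> R).
Hypothesis dist_metric : is_metric dist.
Hypothesis dist_compat : metric_compatible dist.
Hypothesis dist_complete : metric_complete dist.
Variable xs : nat -> E.
Hypothesis xs_dense : forall y e, 0 < e -> exists n, dist (xs n) y < e.
Variable c : E -> E -> R.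
Hypothesis c_qpm : quasi_pseudo_metric c.
Hypothesis c_lsc : lower_semicontinuous (fun p : E * E => (c p.1 p.2)%:E).
Variables (mu nu : probability (borel E) R) (x0 : E).
Hypothesis integrable_mu : forall f, measurable_Lip1 c f ->
  mu.-integrable setT (EFin \o (f : borel E -> R)).
Hypothesis integrable_nu : forall f, measurable_Lip1 c f ->
  nu.-integrable setT (EFin \o (f : borel E -> R)).
Hypothesis integrable_c : nu.-integrable setT (EFin \o (c^~ x0 : borel E -> R)).
Variable S : R.
Hypothesis S_ub : forall f, measurable_Lip1 c f ->
  \int[mu]_(x in setT) f x - \int[nu]_(x in setT) f x <= S.

Let c_ge0 x y : 0 <= c x y. Proof. by case: c_qpm. Qed.
Let c_xx x : c x x = 0. Proof. by case: c_qpm. Qed.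
Let c_triangle x y z : c x z <= c x y + c y z. Proof. by case: c_qpm. Qed.

(* Off a set of small [nu]-measure the infimum in the definition of the
   potential runs over compact pieces of level sets of [psi], which makes the
   potential Borel even though [c] is only lower semicontinuous. *)
Lemma lip_between (phi psi : borel E -> R) (e : R) : 0 < e ->
    finitely_valued psi -> (forall x y, 0 <= phi x + psi y + c x y) ->
  exists (f : E -> R) (K : set (borel E)),
  [/\ measurable_Lip1 c f, measurable K /\ (nu (~` K) < e%:E)%E,
      forall x, - phi x <= f x, forall y, K y -> f y <= psi y
    & forall y, f y <= c y x0 + psi x0].
Proof.
move=> e0 [mpsi [s psis]] H.
have e2 n : 0 < e / 2 / (2 ^ n.+1)%:R :> R.
  by rewrite divr_gt0 ?divr_gt0// ltr0n expn_gt0.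
pose A i : set (borel E) := [set y | psi y = s`_i].
have mA i : measurable (A i).
  by rewrite -[A i]setTI; apply: (mpsi measurableT [set s`_i]); exact: measurable_set1.
have /choice[Q QP] i := compact_inner_regular dist_metric dist_compat
  dist_complete nu xs_dense (mA i) (e2 i).
have mQ i : measurable (Q i) by have [_ /closed_borel] := QP i.
pose K : set (borel E) := \bigcup_(i in [set i | (i < size s)%N]) Q i.
have mK : measurable K by exact: bigcup_measurable.
(* The extra point [x0] makes the infimum run over a nonempty set and bounds [f y] by
   [c y x0 + psi x0] also off [K], where [f] is not compared with [psi y]. *)
pose K' : set E := K `|` [set x0].
pose D x := [set c x y + psi y | y in K'].
pose f x := inf (D x).
have lbD x : has_lbound (D x).
  by exists (- phi x) => _ [y _ <-]; have := H x y => ?; lra.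
have infD x a : (forall y, K' y -> a <= c x y + psi y) -> a <= f x.
  move=> h; apply: lb_le_inf; first by exists (c x x0 + psi x0); exists x0 => //; right.
  by move=> _ [y Ky <-]; exact: h.
have fle x y : K' y -> f x <= c x y + psi y.
  by move=> Ky; apply: ge_inf => //; exists y.
exists f, K; split.
- split.
    move=> x z; rewrite lerBlDr -lerBlDl; apply: (infD) => y Ky.
    by have := fle x y Ky; have := c_triangle x z y => ? ?; lra.
  apply: measurable_fun_lt => r.
  pose C i k : set (borel E) := [set x | exists2 y, Q i y & c x y <= r - s`_i - k.+1%:R^-1].
  pose C0 k : set (borel E) :=
    [set x | exists2 y, [set x0] y & c x y <= r - psi x0 - k.+1%:R^-1].
  (* On [Q i] the function [psi] is constant, so the sets [C i k] are sections over a compact set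
     and hence closed. The slack [k.+1^-1] writes the strict inequality [f x < r] as a countable
     union of non-strict ones. *)
  rewrite (_ : [set x | _] =
    \bigcup_k C0 k `|` \bigcup_(i in [set i | (i < size s)%N]) \bigcup_k C i k).
    apply: measurableU; first apply: bigcup_measurable => k _.
      apply: closed_borel; apply: closed_compact_section => //; exact: compact_set1.
    apply: bigcup_measurable => i _; apply: bigcup_measurable => k _.
    by apply: closed_borel; apply: closed_compact_section => //; have [] := QP i.
  apply/seteqP; split=> x /=.
    have Dx0 : D x !=set0 by exists (c x x0 + psi x0); exists x0 => //; right.
    move=> /(inf_lt Dx0)[_ [y Ky <-]]; rewrite -subr_gt0 => yr.
    have [k /(_ k (leqnn k)) kr] := harmonic_lt yr.
    case: Ky => [[i si Qy]|y0]; [right|left].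
      exists i => //; exists k => //; exists y => //.
      have [_ _ /(_ y Qy) Ay _] := QP i; rewrite -Ay.
      by move: k.+1%:R^-1 kr => h kr; lra.
    exists k => //; exists y => //; rewrite -y0.
    by move: k.+1%:R^-1 kr => h kr; lra.
  have k0 k : 0 < k.+1%:R^-1 :> R by rewrite invr_gt0.
  move=> [[k _ [y y0 cy]]|[i si [k _ [y Qy cy]]]].
    have := fle x y (or_intror y0); rewrite y0 in cy *.
    by move: k.+1%:R^-1 (k0 k) cy => h h0 ? ?; lra.
  have := fle x y (or_introl (ex_intro2 _ _ i si Qy)).
  have [_ _ /(_ y Qy) Ay _] := QP i; rewrite Ay.
  by move: k.+1%:R^-1 (k0 k) cy => h h0 ? ?; lra.
- split=> //; apply: (@le_lt_trans _ _ (nu (\bigcup_i (A i `\` Q i)))).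
    have mAQ i : measurable (A i `\` Q i) by exact: measurableD.
    apply: le_measure; rewrite ?inE; [exact: measurableC|exact: bigcup_measurable|].
    move=> y nKy; exists (index (psi y) s) => //; split.
      by rewrite /A/= nth_index.
    by move=> Qy; apply: nKy; exists (index (psi y) s) => //=; rewrite index_mem.
  apply: (@le_lt_trans _ _ (e / 2)%:E); last by rewrite lte_fin; lra.
  apply: bigcup_geometric_small => //; first by rewrite divr_ge0 ?ltW.
    by move=> i; exact: measurableD.
  by move=> i; apply: ltW; have [] := QP i.
- by move=> x; apply: infD => y _; have := H x y => ?; lra.
- by move=> y Ky; have := fle y y (or_introl Ky); rewrite c_xx add0r.
- by move=> y; apply: fle; right.
Qed.

(** The function [f] of [lip_between] lies below [psi] only on [K]. Elsewhere its excess is at most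
    the integrable [g], and the complement of [K] is chosen so small that [g] integrates to less
    than [e] over it. *)
Let weak_duality1 (phi psi : borel E -> R) :
    finitely_valued phi -> finitely_valued psi ->
    (forall x y, 0 <= phi x + psi y + c x y) ->
  0 <= \int[mu]_(x in setT) phi x + \int[nu]_(x in setT) psi x + S.
Proof.
move=> fphi fpsi H; apply/ler_addgt0Pr => e e0.
have [M psiM] := finitely_valued_bounded fpsi.
(* [M + M] bounds [psi x0 - psi y], whence [f y - psi y <= g y]. *)
pose g (y : borel E) : R := c y x0 + (M + M).
have ig : nu.-integrable setT (EFin \o g).
  rewrite (_ : _ \o _ = (EFin \o (c^~ x0)) \+ (EFin \o cst (M + M)))//.
  by apply: integrableD => //; exact: finite_measure_integrable_cst.
have g0 y : 0 <= g y.
  by rewrite addr_ge0// addr_ge0// (le_trans (normr_ge0 _) (psiM x0)).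
have [del [del0 Hdel]] := integral_normr_continuous ig e0.
have [f [K [Lf [mK nuK] phif fpsiK fc]]] := lip_between del0 fpsi H.
have := S_ub Lf.
have imu := integrable_mu Lf; have inu := integrable_nu Lf.
have : \int[mu]_(x in setT) (-1 * phi x) <= \int[mu]_(x in setT) f x.
  apply: le_Rintegral => //.
    by apply: finitely_valued_integrable; exact: finitely_valuedZ.
  by move=> x _; rewrite mulN1r.
rewrite RintegralZl//; last exact: finitely_valued_integrable.
have mCK : measurable (~` K) by exact: measurableC.
have ignK : nu.-integrable setT (EFin \o (g \_ (~` K))).
  rewrite (_ : _ \o _ = (EFin \o g) \_ (~` K)); last first.
    by apply/funext => y; rewrite /= !patchE; case: ifP.
  apply/(integrable_mkcond _ mCK).1; exact: integrableS ig.
have ipsi : nu.-integrable setT (EFin \o psi) by exact: finitely_valued_integrable.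
have : \int[nu]_(x in setT) f x <= \int[nu]_(x in setT) (psi x + (g \_ (~` K)) x).
  apply: le_Rintegral => //.
    rewrite (_ : _ \o _ = (EFin \o psi) \+ (EFin \o (g \_ (~` K))))//.
    exact: integrableD.
  move=> y _; rewrite patchE; case: ifPn.
    rewrite inE => nKy; have := fc y; have := psiM y; have := psiM x0.
    rewrite /g !ler_norml => /andP[? ?] /andP[? ?] ?; lra.
  by rewrite notin_setE/= => /contrapT/fpsiK; rewrite addr0.
rewrite RintegralD//.
have : \int[nu]_(x in setT) (g \_ (~` K)) x < e.
  rewrite -Rintegral_mkcond; apply: le_lt_trans (Hdel _ mCK nuK).
  by apply: le_trans (ler_norm _) _; apply: le_normr_Rintegral => //; exact: integrableS ig.
move=> *; lra.
Qed.

(** A factor [k > lam] is positive and can be divided out, which reduces to the factor [1]; the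
    constraint survives the increase because [c >= 0]. Letting [k] tend to [lam] also covers
    [lam = 0]. *)
Lemma weak_duality (phi psi : borel E -> R) (lam : R) :
    finitely_valued phi -> finitely_valued psi -> 0 <= lam ->
    (forall x y, 0 <= phi x + psi y + lam * c x y) ->
  0 <= \int[mu]_(x in setT) phi x + \int[nu]_(x in setT) psi x + lam * S.
Proof.
move=> fphi fpsi lam0 H.
have S0 : 0 <= S.
  have L0 : measurable_Lip1 c (cst 0 : E -> R).
    by split; [move=> x y; rewrite subr0|exact: measurable_cst].
  by have := S_ub L0; rewrite !Rintegral_cst// !mul0r subr0.
have lt_lam k : lam < k ->
    0 <= \int[mu]_(x in setT) phi x + \int[nu]_(x in setT) psi x + k * S.
  move=> lamk; have k0 : 0 < k by exact: le_lt_trans lamk.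
  have := @weak_duality1 (fun x => k^-1 * phi x) (fun x => k^-1 * psi x)
    (finitely_valuedZ _ fphi) (finitely_valuedZ _ fpsi).
  rewrite !RintegralZl//; [|exact: finitely_valued_integrable..].
  rewrite -(pmulr_rge0 _ k0) !mulrDr !mulrA mulfV ?gt_eqF// !mul1r; apply.
  move=> x y; rewrite -(pmulr_rge0 _ k0) !mulrDr !mulrA mulfV ?gt_eqF// !mul1r.
  by rewrite (le_trans (H x y))// lerD2l ler_wpM2r// ltW.
apply/ler_addgt0Pr => e e0.
have S1 : 0 < S + 1 by lra.
(* The increment costs [e * S / (S + 1) <= e]; adding [1] keeps the denominator positive when
   [S = 0]. *)
have := lt_lam (lam + e / (S + 1)); rewrite ltrDl divr_gt0// => /(_ isT).
move=> /le_trans; apply; rewrite mulrDl addrA lerD2l.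
by rewrite mulrAC ler_pdivrMr// ler_pM2l//; lra.
Qed.

End weak_duality.

(** * A finitely additive coupling from Hahn-Banach *)

Section mean_coupling.
Context d1 d2 (T1 : measurableType d1) (T2 : measurableType d2) (R : realType).
Variables (mu : probability T1 R) (nu : probability T2 R).
Variables (c : T1 -> T2 -> R) (S : R).
Hypothesis duality : forall (phi : T1 -> R) (psi : T2 -> R) (lam : R),
  finitely_valued phi -> finitely_valued psi -> 0 <= lam ->
  (forall x y, 0 <= phi x + psi y + lam * c x y) ->
  0 <= \int[mu]_(x in setT) phi x + \int[nu]_(y in setT) psi y + lam * S.

Let dominates (g : T1 * T2 -> R) (phi : T1 -> R) (psi : T2 -> R) (lam : R) :=
  [/\ finitely_valued phi, finitely_valued psi, 0 <= lam &
    forall t, g t <= phi t.1 + psi t.2 + lam * c t.1 t.2].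

Let cost (phi : T1 -> R) (psi : T2 -> R) (lam : R) :=
  \int[mu]_(x in setT) phi x + \int[nu]_(y in setT) psi y + lam * S.

(** The superhedging price of [g]: a portfolio consists of a claim on each coordinate and [lam]
    copies of [c] at price [S] each. The codomain [R^o] makes the functions a module over [R]. *)
Let price (g : T1 * T2 -> R^o) : R :=
  inf [set r | exists phi psi (lam : R), dominates g phi psi lam /\ r = cost phi psi lam].

Let costD phi1 phi2 psi1 psi2 lam1 lam2 : finitely_valued phi1 ->
    finitely_valued phi2 -> finitely_valued psi1 -> finitely_valued psi2 ->
  cost (fun x => phi1 x + phi2 x) (fun y => psi1 y + psi2 y) (lam1 + lam2) =
  cost phi1 psi1 lam1 + cost phi2 psi2 lam2.
Proof.
move=> *; rewrite /cost !RintegralD//; try exact: finitely_valued_integrable.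
lra.
Qed.

Let costZ k phi psi lam : finitely_valued phi -> finitely_valued psi ->
  cost (fun x => k * phi x) (fun y => k * psi y) (k * lam) = k * cost phi psi lam.
Proof.
move=> *; rewrite /cost !RintegralZl//; try exact: finitely_valued_integrable.
lra.
Qed.

Let Rintegral_one d (T : measurableType d) (P : probability T R) k :
  \int[P]_(x in setT) k = k.
Proof.
transitivity (k * fine (P setT)); first exact: Rintegral_cst.
by rewrite probability_setT mulr1.
Qed.

(** Absence of arbitrage: adding [M] to [phi] makes the dominating portfolio nonnegative, so
    [duality] applies. This bounds from below the set whose infimum is [price]. *)
Let dominates_cost (g : T1 * T2 -> R) M phi psi lam : (forall t, - M <= g t) ->
  dominates g phi psi lam -> - M <= cost phi psi lam.
Proof.
move=> gM [fphi fpsi lam0 H].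
have := @duality (fun x => phi x + M) psi lam
  (finitely_valuedD fphi (finitely_valued_cst T1 M)) fpsi lam0.
rewrite RintegralD//; try exact: finitely_valued_integrable.
  rewrite (Rintegral_one mu M) /cost => D; rewrite -subr_ge0 opprK.
  suff /D : forall x y, 0 <= phi x + M + psi y + lam * c x y by lra.
  by move=> x y; have := gM (x, y); have := H (x, y) => /= ? ?; lra.
by apply: finitely_valued_integrable; exact: finitely_valued_cst.
Qed.

Let price_le g phi psi lam : bounded_real g -> dominates g phi psi lam ->
  price g <= cost phi psi lam.
Proof.
move=> [M gM] D; apply: ge_inf; last by exists phi, psi, lam.
exists (- M) => _ [phi' [psi' [lam' [D' ->]]]]; apply: dominates_cost D' => t.
by have := gM t; rewrite ler_norml => /andP[].
Qed.

Let price_ge g r : bounded_real g ->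
  (forall phi psi lam, dominates g phi psi lam -> r <= cost phi psi lam) ->
  r <= price g.
Proof.
move=> [M gM] H; apply: lb_le_inf; last first.
  by move=> _ [phi [psi [lam [D ->]]]]; exact: H.
exists (cost (cst M) (cst 0) 0), (cst M), (cst 0), 0; split=> //.
split; [exact: finitely_valued_cst..|by []|] => t.
by rewrite /= mul0r !addr0 (le_trans (ler_norm _)).
Qed.

Let price_sublinear : sublinear bounded_real price.
Proof.
split=> [g h bg bh|k g k0 bg].
  rewrite -lerBlDl; apply: price_ge => // phi2 psi2 lam2 D2.
  rewrite lerBlDl -lerBlDr; apply: price_ge => // phi1 psi1 lam1 D1.
  rewrite lerBlDr.
  case: D1 D2 => f1 p1 l1 H1 [f2 p2 l2 H2]; rewrite -costD//.
  apply: price_le; first exact: bounded_realD.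
  split; [exact: finitely_valuedD..|exact: addr_ge0|move=> t].
  rewrite (_ : (g + h) t = g t + h t)// mulrDl.
  by have := H1 t; have := H2 t => /= ? ?; lra.
have H phi psi lam : dominates g phi psi lam ->
    price (k *: g) <= k * cost phi psi lam.
  move=> [f1 p1 l1 H1]; rewrite -costZ//.
  apply: price_le; first exact: bounded_realZ.
  split; [exact: finitely_valuedZ..|exact: mulr_ge0|move=> t].
  by rewrite -mulrA -!mulrDr; apply: ler_wpM2l.
have [k_0|kn0] := eqVneq k 0.
  have [M gM] := bg; rewrite k_0 mul0r.
  have := @H (cst M) (cst 0) 0; rewrite k_0 mul0r; apply.
  split; [exact: finitely_valued_cst..|by []|] => t.
  by rewrite /= mul0r !addr0 (le_trans (ler_norm _)).
have kp : 0 < k by rewrite lt_neqAle eq_sym kn0.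
rewrite -ler_pdivrMl//; apply: price_ge => // phi psi lam /H.
by rewrite ler_pdivrMl.
Qed.

(** A linear functional below [price] is tested on claims with explicit portfolios: [phi] and
    [- phi] fix the marginals, [- g <= 0] gives positivity, and one copy of [c], of cost [S], gives
    the last bound. *)
Theorem mean_coupling : exists L : (T1 * T2 -> R) -> R,
  [/\ is_mean L,
      forall phi, finitely_valued phi ->
        L (fun t => phi t.1) = \int[mu]_(x in setT) phi x,
      forall psi, finitely_valued psi ->
        L (fun t => psi t.2) = \int[nu]_(y in setT) psi y
    & forall g, bounded_real g -> (forall t, g t <= c t.1 t.2) -> L g <= S].
Proof.
have [L [LD LZ Lprice]] := @hahn_banach R (T1 * T2 -> R^o)%type bounded_real
  (@bounded_realD _ _) (@bounded_realZ _ _) price price_sublinear.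
have L_le g phi psi lam : bounded_real g -> dominates g phi psi lam ->
    L g <= cost phi psi lam.
  by move=> bg D; apply: le_trans (Lprice g bg) _; exact: price_le.
have cost_cst0 : cost (cst 0) (cst 0) 0 = 0.
  by rewrite /cost !Rintegral_one mul0r !addr0.
have Lphi phi : finitely_valued phi ->
    L (fun t => phi t.1) = \int[mu]_(x in setT) phi x.
  have le f : finitely_valued f -> L (fun t => f t.1) <= \int[mu]_(x in setT) f x.
    move=> ff; have -> : \int[mu]_(x in setT) f x = cost f (cst 0) 0.
      by rewrite /cost Rintegral_one mul0r !addr0.
    apply: L_le; first by have [M fM] := finitely_valued_bounded ff; exists M.
    by split=> //; [exact: finitely_valued_cst|move=> t; rewrite mul0r !addr0].
  move=> fphi; apply/eqP; rewrite eq_le le//=.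
  have := le _ (finitely_valuedZ (-1) fphi).
  rewrite RintegralZl//; last exact: finitely_valued_integrable.
  have [M fM] := finitely_valued_bounded fphi.
  have -> := LZ (-1) (fun t => phi t.1) (ex_intro _ M (fun t => fM t.1)).
  by lra.
have Lpsi psi : finitely_valued psi ->
    L (fun t => psi t.2) = \int[nu]_(x in setT) psi x.
  have le f : finitely_valued f -> L (fun t => f t.2) <= \int[nu]_(x in setT) f x.
    move=> ff; have -> : \int[nu]_(x in setT) f x = cost (cst 0) f 0.
      by rewrite /cost Rintegral_one mul0r !addr0 add0r.
    apply: L_le; first by have [M fM] := finitely_valued_bounded ff; exists M.
    by split=> //; [exact: finitely_valued_cst|move=> t; rewrite mul0r addr0 add0r].
  move=> fpsi; apply/eqP; rewrite eq_le le//=.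
  have := le _ (finitely_valuedZ (-1) fpsi).
  rewrite RintegralZl//; last exact: finitely_valued_integrable.
  have [M fM] := finitely_valued_bounded fpsi.
  have -> := LZ (-1) (fun t => psi t.2) (ex_intro _ M (fun t => fM t.2)).
  by lra.
exists L; split=> //.
- split; [exact: LD|exact: LZ| |].
    move=> g bg g0; rewrite -oppr_le0 -mulN1r -[leLHS](LZ (-1) g bg) -cost_cst0.
    apply: L_le; first exact: bounded_realZ.
    split; [exact: finitely_valued_cst..|by []|move=> t].
    rewrite mul0r !addr0 (_ : _ t = - g t) ?oppr_le0//.
    exact: (mulN1r (g t)).
  by rewrite (Lphi (cst 1)) ?Rintegral_one//; exact: finitely_valued_cst.
- move=> g bg gc; have -> : S = cost (cst 0) (cst 0) 1.
    by rewrite /cost !Rintegral_one mul1r !add0r.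
  apply: L_le => //; split; [exact: finitely_valued_cst..|by []|move=> t].
  by rewrite mul1r !add0r.
Qed.

End mean_coupling.

(** * From the mean to a pair of random points *)

Section coupling_realization.
Context {R : realType} {E : ptopologicalType} (dist : E -> E -> R).
Hypothesis dist_metric : is_metric dist.
Hypothesis dist_compat : metric_compatible dist.
Hypothesis dist_complete : metric_complete dist.
Variable xs : nat -> E.
Hypothesis xs_dense : forall y e, 0 < e -> exists n, dist (xs n) y < e.

Let distC x y : dist x y = dist y x. Proof. by case: dist_metric. Qed.
Let dist_triangle x y z : dist x z <= dist x y + dist y z.
Proof. by case: dist_metric. Qed.

Lemma harmonic_cauchy_limit (u : nat -> E) :
    (forall m n, dist (u m) (u n) <= m.+1%:R^-1 + n.+1%:R^-1) ->
  exists l, forall n, dist (u n) l <= n.+1%:R^-1.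
Proof.
move=> uC; have [l ul] := cauchy_harmonic_cvg dist_complete uC.
exists l => n; apply/ler_addgt0Pr => e e0.
have e2 : 0 < e / 2 by rewrite divr_gt0.
have [N1 H1] := harmonic_lt e2.
have [N2 H2] := cvg_dist_lt dist_compat ul e2.
pose m := maxn N1 N2.
have := H1 m (leq_maxl _ _); have := H2 m (leq_maxr _ _).
have := uC n m; have := dist_triangle (u n) (u m) l; rewrite (distC l).
by move: (n.+1%:R^-1) (m.+1%:R^-1) => a b *; lra.
Qed.

Let part_ex n x : exists i, dist (xs i) x < n.+1%:R^-1.
Proof. by apply: xs_dense; rewrite invr_gt0. Qed.

Definition part n x := ex_minn (part_ex n x).

Lemma dist_part n x : dist (xs (part n x)) x < n.+1%:R^-1.
Proof. by rewrite /part; case: ex_minnP. Qed.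

Lemma measurable_part n (N : set nat) :
  measurable ([set x | N (part n x)] : set (borel E)).
Proof.
have mi i : measurable ([set x | (i <= part n x)%N] : set (borel E)).
  rewrite (_ : [set x | _] =
      \bigcap_(j in [set j | (j < i)%N]) ~` [set x | dist (xs j) x < n.+1%:R^-1]).
    apply: bigcap_measurableType => j _; apply: measurableC; apply: open_borel.
    exact: open_dist_ball.
  apply/seteqP; split=> x /=.
    move=> ix j /= ji xj; move: ix; rewrite leqNgt => /negP; apply.
    apply: leq_ltn_trans ji; rewrite /part; case: ex_minnP => k _.
    by move=> /(_ j xj).
  move=> H; rewrite leqNgt; apply/negP => /H; apply; exact: dist_part.
rewrite (_ : [set x | _] = \bigcup_(i in N)
    ([set x | (i <= part n x)%N] `\` [set x | (i.+1 <= part n x)%N])).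
  by apply: bigcup_measurable => i _; exact: measurableD.
apply/seteqP; split=> x /=.
  by move=> Nx; exists (part n x) => //; split=> //=; rewrite ltnn.
by move=> [i Ni [/= ix /negP]]; rewrite -leqNgt => xi;
  rewrite (_ : part n x = i)//; apply/eqP; rewrite eqn_leq xi ix.
Qed.

Section marginal.
Context d (O : measurableType d) (P : probability O R).
Variables (mu : probability (borel E) R) (b : nat -> O -> nat) (X : O -> borel E).
Hypothesis bX : forall n u, dist (xs (b n u)) (X u) <= n.+1%:R^-1.
Hypothesis mb : forall n (N : set nat), measurable [set u | N (b n u)].
Hypothesis Pb : forall n (N : set nat),
  (P [set u | N (b n u)] <= mu [set x | N (part n x)])%E.

Let near_set (F : set E) n := [set i | exists2 y, F y & dist (xs i) y <= n.+1%:R^-1].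

(** [X u] lies in [F] exactly when at every scale the centre [xs (b n u)] is close to [F], a
    countable intersection of events on labels. *)
Let measurable_closed_preimage (F : set E) : closed F -> measurable (X @^-1` F).
Proof.
move=> cF; rewrite (_ : _ @^-1` _ = \bigcap_n [set u | near_set F n (b n u)]).
  by apply: bigcapT_measurable => n; exact: mb.
apply/seteqP; split=> u /= Fu; first by move=> n _; exists (X u).
apply: cF => A /dist_compat[e e0 eA].
have [n /(_ n (leqnn n)) ne] := harmonic_lt (divr_gt0 e0 (ltr0n _ 2)).
have [y Fy yn] := Fu n I; exists y; split=> //; apply: eA => /=.
have := dist_triangle (X u) (xs (b n u)) y; have := bX n u; rewrite (distC (X u) (xs _)).
by move: (n.+1%:R^-1) ne yn => a *; lra.
Qed.

Lemma measurable_limit : measurable_fun setT X.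
Proof.
apply: (@measurability _ _ O (borel E) setT X (@open E)) => [//|_ [U oU <-]].
rewrite setTI -(setCK U) preimage_setC; apply: measurableC.
by apply: (@measurable_closed_preimage (~` U)); exact: open_closedC.
Qed.

HB.instance Definition _ := isMeasurableFun.Build _ _ _ _ X measurable_limit.

Let PX : probability (borel E) R := distribution P X.

(** When [X u] is in [F], its label at scale [n] belongs to a centre close to [F]. Under [mu],
    points with such a label lie in a neighbourhood of [F], and these neighbourhoods shrink to
    [F]. *)
Let PX_closed (F : set E) : closed F -> (PX F <= mu F)%E.
Proof.
move=> cF; have mF := closed_borel cF.
have mnF n : measurable (nbhd dist F n : set (borel E)).
  by apply: open_borel; exact: open_nbhd.
apply/lee_addgt0Pr => e e0.
have [|||k muk] := @decreasing_to_empty_small _ (borel E) _ mu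
    (fun n => nbhd dist F n `\` F) e e0.
- by move=> n; exact: measurableD.
- by move=> n m nm; apply: setSD; exact: nbhd_le.
- rewrite -subset0 => x H; have [_ nF] := H 0%N I; apply: nF.
  by rewrite -(bigcap_nbhd dist_metric dist_compat cF) => n _; have [] := H n I.
(* Here [n.+1 = 2 * k.+1], so the distances from a point of [F] to the centre and from the centre to
   [x] add up to less than [k.+1^-1]. *)
pose n := (k.*2).+1.
apply: (@le_trans _ _ (P [set u | near_set F n (b n u)])).
  rewrite /PX/= /distribution/= /pushforward; apply: le_measure; rewrite ?inE.
  - exact: measurable_closed_preimage.
  - exact: mb.
  - by move=> u Fu; exists (X u).
apply: (le_trans (Pb _ _)).
apply: (@le_trans _ _ (mu (F `|` (nbhd dist F k `\` F)))).
  apply: le_measure; rewrite ?inE.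
  - exact: measurable_part.
  - by apply: measurableU => //; exact: measurableD.
  move=> x [y Fy yx]; have [Fx|nFx] := pselect (F x); [by left|right; split=> //].
  exists y => //=; have := dist_triangle y (xs (part n x)) x.
  have := dist_part n x; rewrite (distC y (xs _)).
  have -> : k.+1%:R^-1 = n.+1%:R^-1 + n.+1%:R^-1 :> R.
    by rewrite /n -addnn -addnS -addSn natrD; field; rewrite -?natr1 ?gt_eqF//; nra.
  by move: yx; move: (n.+1%:R^-1) => a *; lra.
apply: (le_trans (measureU2 _ _ _)) => //; first exact: measurableD.
by rewrite leeD2l// ltW.
Qed.

Let PX_le (A : set (borel E)) : measurable A -> (PX A <= mu A)%E.
Proof.
move=> mA; apply/lee_addgt0Pr => e e0.
have [F [cF FA PF]] := closed_inner_regular dist_metric dist_compat PX mA e0.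
have mF := closed_borel cF.
apply: (@le_trans _ _ (PX F + PX (A `\` F))%E).
  rewrite -[leLHS](_ : PX (F `|` (A `\` F)) = _)%E; last by rewrite setDUK.
  by apply: measureU2 => //; exact: measurableD.
apply: leeD; last exact: ltW.
by apply: le_trans (PX_closed cF) _; apply: le_measure; rewrite ?inE.
Qed.

(** Domination by [mu] passes from closed to Borel sets by inner regularity. Applied to a set and to
    its complement it forces equality, both total masses being [1]. *)
Lemma limit_law (A : set (borel E)) : measurable A -> P (X @^-1` A) = mu A.
Proof.
move=> mA; apply/eqP; rewrite eq_le; apply/andP; split; first exact: PX_le.
have := PX_le (measurableC mA); rewrite !probability_setC//.
have : mu A \is a fin_num by exact: fin_num_measure.
have : PX A \is a fin_num by exact: fin_num_measure.
rewrite -[P _]/(PX A).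
move: (mu A) (PX A) => [a| |] [r| |]//= _ _; rewrite -!EFinB !lee_fin; lra.
Qed.

End marginal.

Section realization.
Variables (c : E -> E -> R) (S : R) (mu nu : probability (borel E) R).
Variable L : (E * E -> R) -> R.
Hypothesis c_ge0 : forall x y, 0 <= c x y.
Hypothesis c_lsc : lower_semicontinuous (fun p : E * E => (c p.1 p.2)%:E).
Hypothesis meanL : is_mean L.
Hypothesis L_fst : forall A : set (borel E), measurable A ->
  L (fun t => (t.1 \in A)%:R) = fine (mu A).
Hypothesis L_snd : forall A : set (borel E), measurable A ->
  L (fun t => (t.2 \in A)%:R) = fine (nu A).
Hypothesis L_c : forall g, bounded_real g -> (forall t, g t <= c t.1 t.2) -> L g <= S.

(** Both coordinates share one sequence of labels, so that a single random branch carries their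
    joint behaviour. *)
Let idx l (t : E * E) := part l./2 (if odd l then t.2 else t.1).

Let L_part1 n (N : set nat) :
  (L (fun t => `[< N (part n t.1) >]%:R))%:E = mu [set x | N (part n x)].
Proof.
rewrite -[RHS]fineK; last by apply: fin_num_measure; exact: measurable_part.
by rewrite -L_fst//; exact: measurable_part.
Qed.

Let L_part2 n (N : set nat) :
  (L (fun t => `[< N (part n t.2) >]%:R))%:E = nu [set x | N (part n x)].
Proof.
rewrite -[RHS]fineK; last by apply: fin_num_measure; exact: measurable_part.
by rewrite -L_snd//; exact: measurable_part.
Qed.

Let part_tail (P : probability (borel E) R) n e : 0 < e ->
  exists K, (P [set x | (K <= part n x)%N] < e%:E)%E.
Proof.
move=> e0; apply: (@decreasing_to_empty_small _ (borel E) _ P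
  (fun K => [set x | (K <= part n x)%N])) => //.
- by move=> K; exact: (@measurable_part n (fun i => K <= i)%N).
- by move=> K K' KK' x /=; exact: leq_trans.
- by rewrite -subset0 => x /(_ (part n x).+1 I)/=; rewrite ltnn.
Qed.

(** Each label depends on one coordinate only, whose law under [L] is [mu] or [nu]; the countable
    additivity of these measures controls the tail. *)
Let idx_tail l e : 0 < e -> exists K, L (fun t => (K <= idx l t)%N%:R) < e.
Proof.
move=> e0; rewrite /idx; case: (odd l).
  have [K] := part_tail nu l./2 e0; rewrite -(L_part2 _ (fun i => K <= i)%N) lte_fin.
  by under eq_fun do rewrite asboolb; exists K.
have [K] := part_tail mu l./2 e0; rewrite -(L_part1 _ (fun i => K <= i)%N) lte_fin.
by under eq_fun do rewrite asboolb; exists K.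
Qed.

(** A lower approximation of [c] that depends on labels alone. The balls are closed because the
    limit points satisfy only non-strict distance bounds. *)
Let ball_cost m i j : R := inf [set r | exists x y,
  [/\ dist (xs i) x <= m.+1%:R^-1, dist (xs j) y <= m.+1%:R^-1 & r = c x y]].

Let dist_xx x : dist x x = 0. Proof. by case: dist_metric. Qed.

Let ball_cost_ge m i j r : (forall x y, dist (xs i) x <= m.+1%:R^-1 ->
  dist (xs j) y <= m.+1%:R^-1 -> r <= c x y) -> r <= ball_cost m i j.
Proof.
move=> H; apply: lb_le_inf; last by move=> _ [x [y [ix jy ->]]]; exact: H.
by exists (c (xs i) (xs j)), (xs i), (xs j); rewrite !dist_xx invr_ge0.
Qed.

Let ball_cost_le m i j x y : dist (xs i) x <= m.+1%:R^-1 ->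
  dist (xs j) y <= m.+1%:R^-1 -> ball_cost m i j <= c x y.
Proof.
move=> ix jy; apply: ge_inf; last by exists x, y.
by exists 0 => _ [x' [y' [_ _ ->]]].
Qed.

(* Indices [2 m] and [2 m + 1] locate the first and the second point, and a
   history lists the later index first. *)
Let history_cost m (w : seq nat) : R := Num.min m%:R
  (ball_cost m (nth 0%N w 1) (nth 0%N w 0)).

Let history_cost_itv m w : 0 <= history_cost m w <= m%:R.
Proof.
by rewrite /history_cost le_min ler0n ge_min lexx/= andbT; exact: ball_cost_ge.
Qed.

(** [X] and [Y] are the limits of the centres labelled at the even and at the odd places of the
    branch. The costs read off the labels have expectation at most [S] and converge to
    [c (X u) (Y u)]. *)
Lemma mean_realization : exists X Y : {RV (@unit_lebesgue R) >-> borel E},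
  [/\ forall A : set (borel E), measurable A -> distribution unit_lebesgue X A = mu A,
      forall A : set (borel E), measurable A -> distribution unit_lebesgue Y A = nu A
    & (\int[unit_lebesgue]_u (c (X u) (Y u))%:E <= S%:E)%E].
Proof.
have [B [mB PB Bt]] := random_branch meanL idx_tail.
pose O : measurableType _ := measurableTypeR R; pose P : probability O R := unit_lebesgue.
have disc n (h : seq nat -> R) := le_expectation_discrete meanL (mB n) (PB n) (h := h).
(* Two labels of the branch are always labels of a common [t]. If they concern the same coordinate,
   their balls meet at that coordinate of [t], which yields the Cauchy estimates below. *)
have Bidx n m (u : O) : exists t, B n u = idx n t /\ B m u = idx m t.
  have [t] := Bt (maxn n m).+1 u; exists t.
  have hist_nth (s1 s2 : nat -> nat) N : history s1 N = history s2 N ->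
      forall k, (k < N)%N -> s1 k = s2 k.
    elim: N => //= N IH [sN sE] k; rewrite ltnS leq_eqVlt => /predU1P[->//|].
    exact: IH.
  by split; apply/esym; apply: (hist_nth _ _ _ p); rewrite ltnS ?leq_maxl ?leq_maxr.
have headB n (N : set nat) : measurable [set u : O | N (B n u)] /\
    (P [set u | N (B n u)] <= (L (fun t => `[< N (idx n t) >]%:R))%:E)%E.
  pose h (w : seq nat) : R := `[< N (head 0%N w) >]%:R.
  have [||mh hL] := disc n.+1 h; first exact: bounded_real_bool.
    by move=> w; exact: ler0n.
  have mN : measurable [set u : O | N (B n u)].
    rewrite (_ : [set u | _] = setT `&` (h \o fun u => history (B^~ u) n.+1) @^-1` [set 1]).
      by apply: mh => //; exact: measurable_set1.
    rewrite setTI; apply/seteqP; split=> u /=; rewrite /h/=.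
      by move=> Nu; rewrite asboolT.
    by case: asboolP => // _ /eqP; rewrite eq_sym oner_eq0.
  split=> //; apply: le_trans hL.
  by rewrite -(setIT [set u | _]) -integral_indic.
have mBn n N := (headB n N).1; have PBn n N := (headB n N).2.
have lim1 u : exists x, forall n, dist (xs (B n.*2 u)) x <= n.+1%:R^-1.
  apply: harmonic_cauchy_limit => m n.
  have [t [-> ->]] := Bidx m.*2 n.*2 u; rewrite /idx !odd_double !doubleK.
  rewrite (le_trans (dist_triangle _ t.1 _))// lerD//; last rewrite distC.
    exact/ltW/dist_part.
  exact/ltW/dist_part.
have lim2 u : exists x, forall n, dist (xs (B n.*2.+1 u)) x <= n.+1%:R^-1.
  apply: harmonic_cauchy_limit => m n.
  have [t [-> ->]] := Bidx m.*2.+1 n.*2.+1 u.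
  rewrite /idx !oddS !odd_double/= !uphalf_double.
  rewrite (le_trans (dist_triangle _ t.2 _))// lerD//; last rewrite distC.
    exact/ltW/dist_part.
  exact/ltW/dist_part.
have [X HX] := choice lim1; have [Y HY] := choice lim2.
have mX := measurable_limit (O := O) (b := fun n => B n.*2)
  (fun n u => HX u n) (fun n => mBn n.*2).
have mY := measurable_limit (O := O) (b := fun n => B n.*2.+1)
  (fun n u => HY u n) (fun n => mBn n.*2.+1).
pose X' : {RV P >-> borel E} := HB.pack (X : O -> borel E)
  (isMeasurableFun.Build _ _ _ _ (X : O -> borel E) mX).
pose Y' : {RV P >-> borel E} := HB.pack (Y : O -> borel E)
  (isMeasurableFun.Build _ _ _ _ (Y : O -> borel E) mY).
exists X', Y'; split.
- move=> A mA; apply: (limit_law (b := fun n => B n.*2)) => //.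
    move=> n N; apply: le_trans (PBn _ _) _.
    by rewrite -L_part1 /idx odd_double doubleK.
- move=> A mA; apply: (limit_law (b := fun n => B n.*2.+1)) => //.
    move=> n N; apply: le_trans (PBn _ _) _.
    by rewrite -L_part2 /idx oddS odd_double/= uphalf_double.
(* The first two entries of a history of length [m.*2.+2] are the labels at places [m.*2.+1] and
   [m.*2]. Truncating the cost at [m] makes it bounded, as [L_c] requires. *)
pose h m (u : O) := history_cost m (history (B^~ u) m.*2.+2).
have hE m u : h m u = Num.min m%:R (ball_cost m (B m.*2 u) (B m.*2.+1 u)) by [].
have hP m : measurable_fun setT (h m) /\ (\int[P]_u (h m u)%:E <= S%:E)%E.
  have bcost : bounded_real (history_cost m).
    by apply: (@bounded_real_itv _ _ _ 0 m%:R) => w; exact: history_cost_itv.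
  have [|mh hL] := disc m.*2.+2 (history_cost m) bcost.
    by move=> w; have /andP[] := history_cost_itv m w.
  split=> //; apply: le_trans hL _; rewrite lee_fin; apply: L_c.
    by have [M cM] := bcost; exists M => t; exact: cM.
  move=> t; rewrite /history_cost/= ge_min; apply/orP; right.
  rewrite /idx/= !odd_double/= doubleK uphalf_double.
  by apply: ball_cost_le; exact/ltW/dist_part.
have h_le m u : h m u <= c (X u) (Y u).
  by rewrite hE ge_min; apply/orP; right; exact: ball_cost_le.
(* The upper bound is [h_le]. For the lower one, [c] exceeds [c (X u) (Y u) - e] on a neighbourhood
   of the pair; eventually both balls fit inside it and the truncation level [m] passes
   [c (X u) (Y u)]. *)
have h_cvg u : (h m u)%:E @[m --> \oo] --> (c (X u) (Y u))%:E.
  apply: cvg_EFin; first by near=> m.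
  apply/cvgrPdist_le => e e0.
  have [|V [[U W]/= [XU YW] UWV] HV] := c_lsc (x := (X u, Y u)) (a := c (X u) (Y u) - e).
    by rewrite lte_fin/=; lra.
  move: XU YW => /dist_compat[eU eU0 HU] /dist_compat[eW eW0 HW].
  have [N1 HN1] := harmonic_lt (divr_gt0 eU0 (ltr0n _ 2)).
  have [N2 HN2] := harmonic_lt (divr_gt0 eW0 (ltr0n _ 2)).
  pose N3 := Num.bound (c (X u) (Y u)).
  near=> m.
  rewrite ger0_norm ?subr_ge0// lerBlDl -lerBlDr hE le_min; apply/andP; split.
    have : c (X u) (Y u) <= m%:R.
      rewrite ltW// (lt_le_trans (archi_boundP (c_ge0 _ _)))// ler_nat.
      by near: m; exists N3.
    by lra.
  apply: ball_cost_ge => x y xB yB.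
  have {}HN1 : m.+1%:R^-1 < eU / 2 by apply: HN1; near: m; exists N1.
  have {}HN2 : m.+1%:R^-1 < eW / 2 by apply: HN2; near: m; exists N2.
  have Ux : U x.
    apply: HU => /=; have := dist_triangle (X u) (xs (B m.*2 u)) x.
    have := HX u m; rewrite (distC (X u) (xs _)).
    by move: m.+1%:R^-1 HN1 xB {HN2 yB} => a *; lra.
  have Wy : W y.
    apply: HW => /=; have := dist_triangle (Y u) (xs (B m.*2.+1 u)) y.
    have := HY u m; rewrite (distC (Y u) (xs _)).
    by move: m.+1%:R^-1 HN2 yB {HN1 xB} => a *; lra.
  by have := HV (x, y) (UWV (x, y) (conj Ux Wy)); rewrite lte_fin => /ltW.
rewrite (eq_integral (fun u => limn_einf (fun m => (h m u)%:E))); last first.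
  move=> u _; rewrite is_cvg_limn_einfE; last by apply/cvg_ex; eexists; exact: h_cvg.
  by apply/esym/cvg_lim => //; exact: h_cvg.
apply: le_trans (@fatou _ O _ P setT measurableT (fun m u => (h m u)%:E) _ _) _.
- by move=> m; apply/measurable_EFinP; have [] := hP m.
- move=> m u _; rewrite lee_fin.
  by have /andP[] := history_cost_itv m (history (B^~ u) m.*2.+2).
rewrite limn_einf_lim; apply: lime_le; first exact: is_cvg_einfs.
apply: nearW => m; apply: le_trans (hP m).2.
by apply: ereal_inf_lbound; exists m => /=.
Unshelve. all: by end_near. Qed.

End realization.
End coupling_realization.

(** * Measurability of the cost and transfer along laws *)

Section lsc_measurable.
Context {R : realType} {E : ptopologicalType} (dist : E -> E -> R).
Hypothesis dist_metric : is_metric dist.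
Hypothesis dist_compat : metric_compatible dist.
Variable xs : nat -> E.
Hypothesis xs_dense : forall y e, 0 < e -> exists n, dist (xs n) y < e.
Variable c : E -> E -> R.
Hypothesis c_lsc : lower_semicontinuous (fun p : E * E => (c p.1 p.2)%:E).

(** The open set where [a < c] is a countable union of products of balls about the dense sequence,
    which reduces the claim to measurability of [X] and of [Y] separately. *)
Lemma measurable_lsc_comp d (O : measurableType d) (X Y : O -> borel E) :
  measurable_fun setT X -> measurable_fun setT Y ->
  measurable_fun setT (fun u => c (X u) (Y u)).
Proof.
move=> mX mY mT; apply: (measurability _ (RGenOInfty.measurableE R)) => //.
move=> _ [_ [a ->] <-]; rewrite setTI.
pose b n i : set (borel E) := [set y | dist (xs i) y < n.+1%:R^-1].
have mb (Z : O -> borel E) n i : measurable_fun setT Z -> measurable (Z @^-1` b n i).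
  move=> mZ; rewrite -[X in measurable X]setTI; apply: mZ => //.
  by apply: open_borel; exact: open_dist_ball.
pose D n i j := forall x y, b n i x -> b n j y -> a < c x y.
rewrite (_ : _ @^-1` _ = \bigcup_n \bigcup_i \bigcup_(j in [set j | D n i j])
    (X @^-1` b n i `&` Y @^-1` b n j)).
  apply: bigcupT_measurable => n; apply: bigcupT_measurable => i.
  by apply: bigcup_measurable => j _; apply: measurableI; exact: mb.
apply/seteqP; split=> [u|u [n _ [i _ [j Dj [Xu Yu]]]]]; last first.
  by rewrite /= in_itv/= andbT; exact: Dj.
rewrite /= in_itv/= andbT => au.
have [//|V [[U W]/= [XU YW] UWV] HV] := c_lsc (x := (X u, Y u)) (a := a).
move: XU YW => /dist_compat[eU eU0 HU] /dist_compat[eW eW0 HW].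
have [N1 HN1] := harmonic_lt (divr_gt0 eU0 (ltr0n _ 2)).
have [N2 HN2] := harmonic_lt (divr_gt0 eW0 (ltr0n _ 2)).
pose n := maxn N1 N2.
have {}HN1 := HN1 n (leq_maxl _ _); have {}HN2 := HN2 n (leq_maxr _ _).
have n0 : 0 < n.+1%:R^-1 :> R by rewrite invr_gt0.
have [i iX] := xs_dense (X u) n0; have [j jY] := xs_dense (Y u) n0.
have [_ _ distC dist_triangle] := dist_metric.
exists n => //; exists i => //; exists j => //= x y.
rewrite /b /= => ix jy.
have Ux : U x.
  apply: HU => /=; have := dist_triangle (X u) (xs i) x; rewrite (distC (X u) (xs _)).
  by move: n.+1%:R^-1 HN1 iX ix {HN2 n0 jY jy} => r *; lra.
have Wy : W y.
  apply: HW => /=; have := dist_triangle (Y u) (xs j) y; rewrite (distC (Y u) (xs _)).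
  by move: n.+1%:R^-1 HN2 jY jy {HN1 n0 iX ix} => r *; lra.
by have := HV (x, y) (UWV (x, y) (conj Ux Wy)); rewrite lte_fin.
Qed.

End lsc_measurable.

Section law_transfer.
Context {R : realType} {E : ptopologicalType}.
Context d (O : measurableType d) (P : probability O R).
Variables (mu : probability (borel E) R) (X : {RV P >-> borel E}).
Hypothesis X_law : forall A : set (borel E), measurable A -> distribution P X A = mu A.

Lemma integrable_law (f : borel E -> R) : mu.-integrable setT (EFin \o f) ->
  P.-integrable setT (EFin \o (f \o X)).
Proof.
move=> /integrableP[mf fy]; apply/integrableP; split.
  exact: (measurableT_comp mf (measurable_funPT X)).
have := ge0_integral_distribution X (measurableT_comp (@abse_measurable R setT) mf).
move=> /(_ (fun y => abse_ge0 _)) <-.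
apply: le_lt_trans fy; rewrite (eq_measure_integral mu)// => A mA _; exact: X_law.
Qed.

Lemma integral_law (f : borel E -> R) : mu.-integrable setT (EFin \o f) ->
  (\int[P]_w (f (X w))%:E)%E = (\int[mu]_x (f x)%:E)%E.
Proof.
move=> fi; have /integrableP[mf _] := fi.
rewrite -(integral_distribution mf (integrable_law fi)).
by apply: eq_measure_integral => A mA _; exact: X_law.
Qed.

End law_transfer.

Lemma expectation_diff_law {R : realType} {E : ptopologicalType} d
    (O : measurableType d) (P : probability O R) (X Y : {RV P >-> borel E})
    (mu nu : probability (borel E) R) (f : borel E -> R) :
    (forall A : set (borel E), measurable A -> distribution P X A = mu A) ->
    (forall A : set (borel E), measurable A -> distribution P Y A = nu A) ->
    mu.-integrable setT (EFin \o f) -> nu.-integrable setT (EFin \o f) ->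
  ('E_P[(fun w => f (X w) - f (Y w))%R])%E =
  (\int[mu]_(x in setT) f x - \int[nu]_(x in setT) f x)%:E.
Proof.
move=> XE YE fmu fnu; rewrite unlock.
under eq_integral do rewrite EFinB.
rewrite integralB//; [|exact: integrable_law fmu|exact: integrable_law fnu].
rewrite (integral_law XE fmu) (integral_law YE fnu) EFinB /Rintegral.
by rewrite !fineK//; exact: integrable_fin_num.
Qed.

(** * Assembly of the two inequalities *)

Theorem lemma5p5 (R : realType) (E : ptopologicalType) (polishE : polish R E)
    (c : E -> E -> R) (c_qpm : quasi_pseudo_metric c)
    (c_lsc : lower_semicontinuous (fun p : E * E => (c p.1 p.2)%:E))
    (d : measure_display) (O : measurableType d) (P : probability O R)
    (X Y : {RV P >-> borel E})
    (cXY_fin : exists x0 : E,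
      ('E_P[(fun w => c (X w) x0 + c x0 (X w) + c (Y w) x0 + c x0 (Y w))%R]
         < +oo)%E) :
  OT c X Y =
  ereal_sup [set ('E_P[(fun w => f (X w) - f (Y w))%R])%E
            | f in measurable_Lip1 c].
Proof.
have [sepE [dist [distM distC distK]]] := polishE.
have [xs xs_dense] := separable_dense_sequence distM distC sepE.
have [c_ge0 c_xx c_tri] := c_qpm.
have [x0 fin] := cXY_fin; rewrite unlock in fin.
have mc dd (O1 : measurableType dd) (U V : O1 -> borel E) :
    measurable_fun setT U -> measurable_fun setT V ->
    measurable_fun setT (fun u => c (U u) (V u)).
  exact: (measurable_lsc_comp distM distC xs_dense c_lsc).
have mX : measurable_fun setT X := measurable_funPT X.
have mY : measurable_fun setT Y := measurable_funPT Y.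
have m0 : measurable_fun setT (cst x0 : O -> borel E) by exact: measurable_cst.
pose G w := c (X w) x0 + c x0 (X w) + c (Y w) x0 + c x0 (Y w).
have iG : P.-integrable setT (EFin \o G).
  apply/integrableP; split.
    apply/measurable_EFinP; apply: measurable_funD; last exact: (mc _ _ _ _ m0 mY).
    apply: measurable_funD; last exact: (mc _ _ _ _ mY m0).
    apply: measurable_funD; [exact: (mc _ _ _ _ mX m0)|exact: (mc _ _ _ _ m0 mX)].
  apply: le_lt_trans fin; rewrite le_eqVlt; apply/orP; left; apply/eqP.
  by apply: eq_integral => w _ /=; rewrite ger0_norm// !addr_ge0.
pose mu : probability (borel E) R := distribution P X.
pose nu : probability (borel E) R := distribution P Y.
have lip_integrable f : measurable_Lip1 c f ->
    mu.-integrable setT (EFin \o (f : borel E -> R)) /\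
    nu.-integrable setT (EFin \o (f : borel E -> R)).
  move=> [lf mf].
  (* As [c] need not be symmetric, the Lipschitz bound is used in both directions against [x0]; it
     makes every measurable 1-Lipschitz function integrable under both laws. *)
  have fle x : `|f x| <= `|f x0| + (c x x0 + c x0 x).
    have := lf x x0; have := lf x0 x; have := c_ge0 x x0; have := c_ge0 x0 x.
    have := ler_norm (f x0); have := ler_norm (- f x0); rewrite normrN ler_norml.
    by move=> *; apply/andP; split; lra.
  have iGf : P.-integrable setT (EFin \o (fun w => `|f x0| + G w)).
    rewrite (_ : _ \o _ = (EFin \o cst `|f x0|%R) \+ (EFin \o G))%E//.
    by apply: integrableD => //; exact: finite_measure_integrable_cst.
  have mE : measurable_fun setT (EFin \o (f : borel E -> R)) by exact/measurable_EFinP.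
  have bd (x : E) (w : O) : c x x0 + c x0 x <= G w ->
      (`|(f x)%:E| <= `|(`|f x0|%R + G w)%:E|)%E.
    move=> xG; rewrite /= lee_fin (le_trans (fle x))// (le_trans _ (ler_norm _))//.
    by rewrite lerD2l.
  split; apply: integrable_pushforward => //; apply: le_integrable iGf => //.
  - exact: (measurableT_comp mE mX).
  - move=> w _; apply: bd => //; rewrite /G -addrA lerDl addr_ge0//.
  - exact: (measurableT_comp mE mY).
  - by move=> w _; apply: bd => //; rewrite /G -[leRHS]addrA lerDr addr_ge0.
(* Since [c x y <= c x x0 + c x0 y], this function and the next make the cost integrable under every
   coupling: their integrability depends on the marginal laws alone. *)
have lip_c0 : measurable_Lip1 c (c^~ x0).
  split=> [x y|]; first by have := c_tri x y x0; lra.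
  by apply: mc; [exact: measurable_id|exact: measurable_cst].
have lip_0c : measurable_Lip1 c (fun y => - c x0 y).
  split=> [x y|]; first by have := c_tri x0 x y; lra.
  by apply: measurable_funN; apply: mc; [exact: measurable_cst|exact: measurable_id].
have EXY f : measurable_Lip1 c f -> ('E_P[(fun w => f (X w) - f (Y w))%R])%E =
    (\int[mu]_(x in setT) f x - \int[nu]_(x in setT) f x)%:E.
  by move=> /lip_integrable[]; exact: expectation_diff_law.
apply/eqP; rewrite eq_le; apply/andP; split; last first.
  apply: ge_ereal_sup => _ [f lf <-]; apply: le_ereal_inf_tmp => r.
  case=> d2 [] O2 [] P2 [] X2 [] Y2 [] XX2 YY2 ->.
  have [fmu fnu] := lip_integrable f lf.
  rewrite (EXY f lf) -(expectation_diff_law XX2 YY2 fmu fnu) unlock.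
  have mX2 : measurable_fun setT X2 := measurable_funPT X2.
  have mY2 : measurable_fun setT Y2 := measurable_funPT Y2.
  have icX : P2.-integrable setT (EFin \o (fun w => c (X2 w) x0)).
    exact: (integrable_law XX2 (lip_integrable _ lip_c0).1).
  have icY : P2.-integrable setT (EFin \o (fun w => - c x0 (Y2 w))).
    exact: (integrable_law YY2 (lip_integrable _ lip_0c).2).
  apply: le_integral => //.
  - rewrite (_ : (fun w => _) = (EFin \o (f \o X2)) \- (EFin \o (f \o Y2)))%E.
      by apply: integrableB => //; [exact: integrable_law fmu|exact: integrable_law fnu].
    by apply/funext => w /=; rewrite EFinB.
  - apply: le_integrable (integrableB measurableT icX icY) => //.
    + by apply/measurable_EFinP; exact: mc.
    + by move=> w _ /=; rewrite lee_fin opprK !ger0_norm ?addr_ge0//.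
  - by move=> w _; rewrite lee_fin; case: lf => + _; apply.
set Sup := ereal_sup _.
have Sup_ub f : measurable_Lip1 c f ->
    ((\int[mu]_(x in setT) f x - \int[nu]_(x in setT) f x)%:E <= Sup)%E.
  by move=> lf; rewrite -(EXY f lf); apply: ereal_sup_ubound; exists f.
have Sup_0 : (0 <= Sup)%E.
  have l0 : measurable_Lip1 c (cst 0 : E -> R).
    by split=> [x y|]; [rewrite subrr|exact: measurable_cst].
  by have := Sup_ub _ l0; rewrite !Rintegral_cst// !mul0r subr0.
(* The zero function excludes the value [-oo], and for [+oo] the bound is trivial; a finite [S]
   remains. *)
case: Sup Sup_ub Sup_0 => [S S_ub _|_ _|//]; last by rewrite leey.
have wd := weak_duality distM distC distK xs_dense c_qpm c_lsc
  (fun f lf => (lip_integrable f lf).1) (fun f lf => (lip_integrable f lf).2)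
  (lip_integrable _ lip_c0).2 S_ub.
have [L [meanL Lmu Lnu Lc]] := mean_coupling wd.
have Lfst (A : set (borel E)) : measurable A ->
    L (fun t => (t.1 \in A)%:R) = fine (mu A).
  move=> mA; rewrite (Lmu _ (finitely_valued_indic R mA)).
  by rewrite /Rintegral integral_indic// setIT.
have Lsnd (A : set (borel E)) : measurable A ->
    L (fun t => (t.2 \in A)%:R) = fine (nu A).
  move=> mA; rewrite (Lnu _ (finitely_valued_indic R mA)).
  by rewrite /Rintegral integral_indic// setIT.
have [X' [Y' [XX' YY' cS]]] := mean_realization distM distC distK xs_dense
  c_ge0 c_lsc meanL Lfst Lsnd Lc.
apply: le_trans cS.
apply: ereal_inf_lbound.
exists _, _, unit_lebesgue, X', Y'; split=> //.
by rewrite unlock.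
Qed.
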